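(* Let $G$ be an arc-transitive group of automorphisms of a connected cubic symmetric graph $X=X_0$, and let $X_n\xrightarrow{\wp_n}X_{n-1}\to\cdots\to X_2\xrightarrow{\wp_2}X_1\xrightarrow{\wp_1}X_0$ be a $G$-admissible chain of consecutive $2$-covers, with lifted groups $G=G_0,G_1,\dots,G_n$. Then at most two of the $2$-covers $\wp_j$ in the chain are split (relative to $G_{j-1}$). In particular, if precisely two of them are split, then one is split-transitive and the other is split-sectional or split-mixed, and this can happen only if $G$ is $s$-regular for some $s\in\{2,3,5\}$.
   Context: Graphs are finite, simple and connected; maps are composed on the right. An $s$-arc is a sequence $(v_0,\dots,v_s)$ of vertices with $v_{i-1}\sim v_i$ and $v_{i-1}\neq v_{i+1}$; a group is $s$-regular if it acts regularly on $s$-arcs. A regular covering projection $\wp\colon\tilde Y\to Y$ is a surjective graph homomorphism, locally bijective on neighbourhoods, whose group $\mathrm{CT}(\wp)$ of covering transformations (automorphisms $c$ with $c\wp=\wp$) acts regularly on fibres; a $2$-cover has $\mathrm{CT}(\wp)\cong\mathbb{Z}_2$. A lift of $g\in\mathrm{Aut}\,Y$ is $\tilde g$ with $\wp g=\tilde g\wp$; the lifted group $\tilde K$ of $K\leq\mathrm{Aut}\,Y$ is the group of all lifts of its elements. $\wp$ is split relative to $K$ if $K$ lifts and $\mathrm{CT}(\wp)$ has a complement in $\tilde K$. A section is a vertex set meeting each fibre in exactly one vertex; a complement is sectional if it leaves a section invariant, transitive if transitive on $V(\tilde Y)$. For $K$ vertex-transitive, a $K$-split $\wp$ is split-sectional if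 all complements are sectional, split-transitive if all complements are transitive, and split-mixed if both sectional and transitive complements exist. The chain is $G$-admissible if $G_j\leq\mathrm{Aut}\,X_j$ is the lift of $G_{j-1}$ along $\wp_j$ for each $j$. *)

(* Defs.v *)
From mathcomp Require Import all_boot all_fingroup.
Set Implicit Arguments.
Unset Strict Implicit.
Unset Printing Implicit Defensive.

Open Scope group_scope.

Section Graphs.
Variables (V : finType) (e : rel V).

Definition simple_graph : Prop := irreflexive e /\ symmetric e.
Definition connected_graph : Prop := forall x y : V, connect e x y.
Definition cubic_graph : Prop := forall x : V, #|[set y | e x y]| = 3%N.

Definition GAut : {set {perm V}} :=
  [set g : {perm V} | [forall x, forall y, e (g x) (g y) == e x y]].

Definition s_arc (s : nat) (a : (s.+1).-tuple V) : Prop :=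
  (forall i j : 'I_s.+1, nat_of_ord j = (nat_of_ord i).+1 -> e (tnth a i) (tnth a j)) /\
  (forall i k : 'I_s.+1, nat_of_ord k = (nat_of_ord i).+2 -> tnth a i <> tnth a k).

Definition s_regular (s : nat) (K : {set {perm V}}) : Prop :=
  forall a b : (s.+1).-tuple V, s_arc a -> s_arc b ->
    exists! g : {perm V}, g \in K /\ map_tuple g a = b.

Definition arc_transitive (K : {set {perm V}}) : Prop :=
  forall a b : 2.-tuple V, s_arc (s := 1) a -> s_arc (s := 1) b ->
    exists2 g : {perm V}, g \in K & map_tuple g a = b.

End Graphs.

Section Covers.
Variables (V1 V0 : finType) (e1 : rel V1) (e0 : rel V0) (p : V1 -> V0).

Definition graph_hom : Prop := forall x y, e1 x y -> e0 (p x) (p y).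

Definition locally_bijective : Prop :=
  forall x : V1, {in [set y | e1 x y] &, injective p} /\
                 p @: [set y | e1 x y] = [set z | e0 (p x) z].

Definition CT : {set {perm V1}} :=
  [set c in GAut e1 | [forall x, p (c x) == p x]].

Definition regular_cover : Prop :=
  [/\ graph_hom, (forall z : V0, exists x : V1, p x = z), locally_bijective
    & forall x y : V1, p x = p y -> exists2 c, c \in CT & c x = y].

Definition two_cover : Prop := regular_cover /\ #|CT| = 2%N.

(* gt is a lift of g:  p g = gt p  (maps composed on the right) *)
Definition is_lift (g : {perm V0}) (gt : {perm V1}) : Prop :=
  gt \in GAut e1 /\ forall x : V1, p (gt x) = g (p x).

Definition lifts (K : {set {perm V0}}) : Prop :=
  forall g, g \in K -> exists gt, is_lift g gt.

Definition lifted (K : {set {perm V0}}) : {set {perm V1}} :=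
  [set gt in GAut e1 | [exists g in K, [forall x, p (gt x) == g (p x)]]].

Definition split_rel (K : {set {perm V0}}) : Prop :=
  lifts K /\ exists H : {group {perm V1}}, H \in [complements to CT in lifted K].

Definition is_section (S : {set V1}) : Prop :=
  forall z : V0, #|S :&: p @^-1: [set z]| = 1%N.

Definition sectional (H : {set {perm V1}}) : Prop :=
  exists2 S : {set V1}, is_section S & forall h, h \in H -> [set h x | x in S] = S.

Definition transitive_compl (H : {set {perm V1}}) : Prop :=
  [transitive H, on [set: V1] | 'P].

Definition split_sectional (K : {set {perm V0}}) : Prop :=
  split_rel K /\ forall H : {group {perm V1}},
    H \in [complements to CT in lifted K] -> sectional H.

Definition split_transitive (K : {set {perm V0}}) : Prop :=
  split_rel K /\ forall H : {group {perm V1}},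
    H \in [complements to CT in lifted K] -> transitive_compl H.

Definition split_mixed (K : {set {perm V0}}) : Prop :=
  split_rel K /\
  (exists2 H : {group {perm V1}}, H \in [complements to CT in lifted K] & sectional H) /\
  (exists2 H : {group {perm V1}}, H \in [complements to CT in lifted K] & transitive_compl H).

End Covers.

(* Main.v *)
(* A complement of CT in a lifted group has index 2, so a split cover X_(j+1) -> X_j yields a
   homomorphism chi : G_(j+1) -> Z_2 that is nontrivial on CT. Pulled back along the chain, the
   characters of different split covers are linearly independent. An arc-transitive group G on a
   connected cubic graph is s-regular for some s. For s >= 2 the pointwise stabiliser of an
   (s-1)-arc is generated by an involution x, and the conjugates of x together with a shunt t
   generate G, so that a character is determined by the pair (chi x, chi t); for s = 1, where
   vertex stabilisers have order 3, take x = 1. Hence at most two of the covers split. If two do,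
   then some chi has chi x = 1. In that case every relation between the conjugates
   x_i = t^(-i) x t^i has even length, and Tutte's commutator calculus in the stabilisers of arcs
   leaves only s = 2, 3, 5. Finally, a complement is sectional if its character is trivial on the
   vertex stabilisers (i.e. chi x = 0) and transitive otherwise, and the four characters on the
   group G_(j+1) of the upper split cover determine the types of both covers. *)
Require Import Defs.
From mathcomp Require Import all_boot all_fingroup all_solvable zify.
From Stdlib Require Import Classical.
Set Implicit Arguments.
Unset Strict Implicit.
Unset Printing Implicit Defensive.
Local Open Scope group_scope.

(* Homomorphisms to Z_2, i.e. the subgroups of index at most 2. *)
Definition parity (gT : finGroupType) (G : {set gT}) (chi : gT -> bool) : Prop :=
  {in G &, {morph chi : x y / x * y >-> x (+) y}}.

(** * Elementary properties of characters with values in Z_2 *)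

Section Parity.
Variables (gT : finGroupType) (G : {group gT}) (chi : gT -> bool).
Hypothesis chiM : parity G chi.

Lemma parity1 : chi 1 = false.
Proof. by have := chiM (group1 G) (group1 G); rewrite mulg1; case: (chi 1). Qed.

Lemma parityV x : x \in G -> chi x^-1 = chi x.
Proof.
move=> Gx; have Gx' : x^-1 \in G by rewrite groupV.
by have := chiM Gx Gx'; rewrite mulgV parity1; case: (chi x); case: (chi x^-1).
Qed.

Lemma parityJ x y : x \in G -> y \in G -> chi (x ^ y) = chi x.
Proof.
move=> Gx Gy; rewrite /conjg !chiM ?groupM ?groupV // parityV //.
by case: (chi x); case: (chi y).
Qed.

Lemma parityR x y : x \in G -> y \in G -> chi [~ x, y] = false.
Proof.
by move=> Gx Gy; rewrite /commg chiM ?groupJ ?groupV // parityJ // parityV ?addbb.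
Qed.

End Parity.

(** * Arcs in cubic graphs *)

Section Cubic.
Variables (V : finType) (e : rel V).
Hypothesis eS : symmetric e.
Hypotheses (eC : connected_graph e) (e3 : cubic_graph e).

Lemma cubic_two_more u a : e u a ->
  exists b c, [/\ e u b, e u c, b != a, c != a & b != c] /\
    forall z, e u z -> [\/ z = a, z = b | z = c].
Proof.
move=> ua; have := e3 u; rewrite (cardsD1 a) inE ua => -[] /eqP/cards2P[b [c [nbc E]]].
have : b \in [set b; c] by rewrite !inE eqxx.
have : c \in [set b; c] by rewrite !inE eqxx orbT.
rewrite -E !inE => /andP[ca uc] /andP[ba ub].
exists b, c; split=> // z uz; case: (eqVneq z a) => [->|za]; first exact: Or31.
have : z \in [set b; c] by rewrite -E !inE za.
by rewrite !inE => /orP[] /eqP->; [exact: Or32|exact: Or33].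
Qed.

Lemma cubic_other u a : e u a -> exists2 b, e u b & b != a.
Proof. by move=> /cubic_two_more[b [c [[ub _ ba _ _] _]]]; exists b. Qed.

Lemma cubic_third u a b : e u a -> e u b -> a != b ->
  exists c, [/\ e u c, c != a, c != b & forall z, e u z -> [\/ z = a, z = b | z = c]].
Proof.
move=> ua ub ab; have [b' [c [[ub' uc b'a ca b'c] E]]] := cubic_two_more ua.
case: (E b ub) => Eb; first by rewrite Eb eqxx in ab.
  by exists c; split=> //; rewrite Eb // eq_sym.
exists b'; split=> //; rewrite ?Eb // => z /E[]->; [exact: Or31|exact: Or33|exact: Or32].
Qed.

Lemma graph_connected_ind (P : V -> Prop) u :
  P u -> (forall x y, P x -> e x y -> P y) -> forall w, P w.
Proof.
move=> Pu step w; have /connectP[q] := eC u w.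
elim: q u Pu => [|y q IH] x Px /=; first by move=> _ ->.
by move=> /andP[xy /IH]; apply; apply: step xy.
Qed.

Section Auto.
Variables (g : {perm V}) (u a : V).
Hypotheses (gA : g \in GAut e) (gu : g u = u) (ga : g a = a) (ua : e u a).

Lemma GAut_edge (h : {perm V}) x y : h \in GAut e -> e (h x) (h y) = e x y.
Proof. by rewrite inE => /forallP/(_ x)/forallP/(_ y)/eqP. Qed.

Lemma aut_fix_nbrs b z : e u b -> a != b -> g b = b -> e u z -> g z = z.
Proof.
move=> ub ab gb uz; have [c [uc ca cb E]] := cubic_third ua ub ab.
case: (E _ uz) => -> //; have : e u (g c) by rewrite -{1}gu GAut_edge.
case/E=> // gc.
  by have := ca; rewrite -(inj_eq (@perm_inj _ g)) ga gc eqxx.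
by have := cb; rewrite -(inj_eq (@perm_inj _ g)) gb gc eqxx.
Qed.

(** Both automorphisms interchange the two neighbours of [u] other than [a], so one after the other
    restores [b]. *)
Lemma aut_swapK (x : {perm V}) b : x \in GAut e -> x u = u -> x a = a ->
  e u b -> a != b -> g b != b -> x b != b -> x (g b) = b.
Proof.
move=> xA xu xa ub ab gb xb.
have [c [uc ca cb E]] := cubic_third ua ub ab.
have {}gb : g b = c.
  have : e u (g b) by rewrite -{1}gu GAut_edge.
  case/E=> // Eb; last by rewrite Eb eqxx in gb.
  by move: ab; rewrite -(inj_eq (@perm_inj _ g)) ga Eb eqxx.
have {}xb : x b = c.
  have : e u (x b) by rewrite -{1}xu GAut_edge.
  case/E=> // Eb; last by rewrite Eb eqxx in xb.
  by move: ab; rewrite -(inj_eq (@perm_inj _ x)) xa Eb eqxx.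
have : e u (x c) by rewrite -{1}xu GAut_edge.
rewrite gb; case/E=> // Ec.
  by move: ca; rewrite -(inj_eq (@perm_inj _ x)) xa Ec eqxx.
by move: cb; rewrite -(inj_eq (@perm_inj _ x)) xb Ec eqxx.
Qed.
End Auto.

(** Arcs are functions on [nat] of which only the values up to [s] matter, so that prefixes, shifts
    and reversals involve no change of type. *)
Definition is_arc s (f : nat -> V) : Prop :=
  (forall i, (i < s)%N -> e (f i) (f i.+1)) /\
  (forall i, (i.+1 < s)%N -> f i != f i.+2).

Lemma is_arc_prefix s t f : (t <= s)%N -> is_arc s f -> is_arc t f.
Proof. by move=> ts [A B]; split=> i Hi; [apply: A; lia|apply: B; lia]. Qed.

Lemma is_arc_drop s t f : is_arc (t + s) f -> is_arc s (fun i => f (t + i)).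
Proof.
by move=> [A B]; split=> i Hi; rewrite ?addnS; [apply: A; lia|apply: B; lia].
Qed.

Lemma is_arc_rev s f : is_arc s f -> is_arc s (fun i => f (s - i)).
Proof.
move=> [A B]; split=> i Hi.
  by have := A (s - i.+1)%N; rewrite eS; (have -> : (s - i.+1).+1 = s - i by lia); apply; lia.
have := B (s - i.+2)%N; rewrite eq_sym.
by (have -> : (s - i.+2).+2 = s - i by lia); apply; lia.
Qed.

Definition snoc s (f : nat -> V) w i := if (i <= s)%N then f i else w.

Lemma is_arc_snoc s f w : is_arc s f -> e (f s) w ->
  (forall t, s = t.+1 -> f t != w) -> is_arc s.+1 (snoc s f w).
Proof.
move=> [A B] fw ne; split=> i Hi; rewrite /snoc.
  case: (ltnP i s) => Hs; first by rewrite ltnW // A.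
  have -> : i = s by lia.
  by rewrite leqnn.
case: (ltnP i.+1 s) => Hs; first by rewrite (_ : (i <= s)%N) ?B //; lia.
by rewrite ltnW // ne //; lia.
Qed.

Lemma is_arc_extend s f : (0 < s)%N -> is_arc s f ->
  exists f', is_arc s.+1 f' /\ forall i, (i <= s)%N -> f' i = f i.
Proof.
case: s => // s _ fA; have fs := fA.1 s (leqnn _).
rewrite eS in fs; have [w fw nw] := cubic_other fs.
exists (snoc s.+1 f w); split; last by move=> i; rewrite /snoc => ->.
by apply: is_arc_snoc => // t [<-]; rewrite eq_sym.
Qed.

Variable G : {group {perm V}}.
Hypothesis GA : G \subset GAut e.

Lemma edgeG g x y : g \in G -> e (g x) (g y) = e x y.
Proof. by move=> Gg; rewrite GAut_edge ?(subsetP GA). Qed.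

Definition arc_trans s : Prop := forall f f', is_arc s f -> is_arc s f' ->
  exists2 g, g \in G & forall i, (i <= s)%N -> g (f i) = f' i.

Definition arc_free s : Prop := forall f g, is_arc s f -> g \in G ->
  (forall i, (i <= s)%N -> g (f i) = f i) -> g = 1.

(** An element that fixes the arc and moves one prolongation [w] swaps the two possible
    prolongations; hence every arc of length [s.+1] can be carried to [f] followed by [w]. *)
Lemma arc_transS s f g w : (0 < s)%N -> arc_trans s -> is_arc s f -> g \in G ->
  (forall i, (i <= s)%N -> g (f i) = f i) -> e (f s) w -> g w != w -> arc_trans s.+1.
Proof.
move=> s0 Ts fA Gg gf fw gw; case: s => // s in s0 Ts fA gf fw *.
have key a : is_arc s.+2 a -> exists2 h, h \in G &
    (forall i, (i <= s.+1)%N -> h (a i) = f i) /\ h (a s.+2) = w.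
  move=> aA; have [h Gh ha] := Ts a f (is_arc_prefix (leqnSn _) aA) fA.
  have ua : e (f s.+1) (f s) by rewrite eS; apply: fA.1.
  have uz : e (f s.+1) (h (a s.+2)) by rewrite -(ha s.+1) // edgeG // aA.1.
  have za : f s != h (a s.+2) by rewrite -(ha s) // (inj_eq perm_inj) aA.2.
  have fsw : f s != w by apply: contraNneq gw => <-; apply/eqP/gf.
  case: (eqVneq (h (a s.+2)) w) => [hw|hw]; first by exists h.
  exists (h * g); first exact: groupM.
  split=> [i Hi|]; first by rewrite permM ha // gf.
  have [c [uc ca cb E]] := cubic_third ua fw fsw.
  have hc : h (a s.+2) = c.
    by case: (E _ uz) => // E1; [rewrite E1 eqxx in za|rewrite E1 eqxx in hw].
  have : e (f s.+1) (g w) by rewrite -{1}(gf s.+1) // edgeG.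
  rewrite permM hc; case/E=> Egw.
  - by move: fsw; rewrite -(inj_eq (@perm_inj _ g)) gf // Egw eqxx.
  - by rewrite Egw eqxx in gw.
  - have /subsetP/(_ _ Gg) gA := GA.
    have gs : g (f s.+1) = f s.+1 by apply: gf.
    have gs' : g (f s) = f s by apply: gf.
    by rewrite -Egw (aut_swapK gA gs gs' ua gA gs gs' fw fsw gw gw).
move=> a b aA bA; have [h Gh [ha hw]] := key a aA; have [k Gk [kb kw]] := key b bA.
exists (h * k^-1); first by rewrite groupM ?groupV.
move=> i Hi; rewrite permM; apply: (@perm_inj _ k); rewrite permKV.
case: (leqP i s.+1) => Hs; first by rewrite ha // kb.
have -> : i = s.+2 by lia.
by rewrite hw kw.
Qed.

(** By [arc_transS], an element fixing an [s]-arc pointwise fixes all its prolongations. The fixed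
    arc can thus be moved along edges in both directions, and by connectedness it reaches every
    vertex. *)
Lemma arc_free_max s : (0 < s)%N -> arc_trans s -> ~ arc_trans s.+1 -> arc_free s.
Proof.
move=> s0 Ts nT f g fA Gg gf.
have nbr f' w : is_arc s f' -> (forall i, (i <= s)%N -> g (f' i) = f' i) ->
    e (f' s) w -> g w = w.
  move=> fA' gf' fw; apply/eqP/negPn/negP => gw.
  exact: nT (arc_transS s0 Ts fA' Gg gf' fw gw).
pose P u := exists f', [/\ is_arc s f', forall i, (i <= s)%N -> g (f' i) = f' i & f' s = u].
suff Pall u : P u by apply/permP=> u; rewrite perm1; have [f' [_ gf' <-]] := Pall u; apply: gf'.
apply: (graph_connected_ind (u := f s)) => [|x y [f' [fA' gf' fx]] xy]; first by exists f.
case: s => // s in s0 Ts nT fA gf nbr P fA' gf' fx *.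
(* If [y] is the last but one vertex, the arc moves backwards: it gains a vertex [z] before its
   start, which is fixed because the reversed arc can be prolonged, and it loses its end. *)
case: (eqVneq (f' s) y) => [fy|fy].
  have f01 : e (f' 0) (f' 1%N) by apply: fA'.1.
  have [z fz nz] := cubic_other f01.
  pose rf := snoc s.+1 (fun i => f' (s.+1 - i)) z.
  have rA : is_arc s.+2 rf.
    apply: is_arc_snoc; first exact: is_arc_rev.
      by rewrite subnn.
    by move=> t [<-]; rewrite subSnn eq_sym.
  have grf : forall i, (i <= s.+2)%N -> g (rf i) = rf i.
    move=> i Hi; rewrite /rf /snoc; case: ifP => H; first by apply: gf'; lia.
    apply: (nbr (fun i => f' (s.+1 - i))); last by rewrite subnn.
      exact: is_arc_rev.
    by move=> k Hk; apply: gf'; lia.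
  exists (fun i => rf (s.+2 - i)); split=> [|i Hi|].
  - by apply: (is_arc_prefix (leqnSn s.+1)); apply: is_arc_rev.
  - by apply: grf; lia.
  - by rewrite subSnn /rf /snoc ltn0Sn -fy subSS subn0.
have gy : g y = y by apply: nbr fA' gf' _; rewrite fx.
have yA : is_arc s.+2 (snoc s.+1 f' y).
  by apply: is_arc_snoc; rewrite ?fx // => t [<-].
exists (fun i => snoc s.+1 f' y (1 + i)%N); split=> [|i Hi|].
- exact: (is_arc_drop (t := 1%N)).
- by rewrite /snoc; case: ifP => H //; apply: gf'.
- by rewrite /snoc add1n ltnn.
Qed.

Lemma long_arc u w s : e u w -> (0 < s)%N ->
  exists f, [/\ is_arc s f, f 0 = u & f 1%N = w].
Proof.
move=> uw; elim: s => // -[_ _|s IH _].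
  exists (fun i => if i is 0 then u else w); split=> //; split=> -[] //.
have [//|f [fA f0 f1]] := IH.
have [f' [fA' E]] := is_arc_extend (ltn0Sn _) fA.
by exists f'; split=> //; rewrite E.
Qed.

Definition arc_stab (f : nat -> V) k := [set g in G | [forall i : 'I_k.+1, g (f i) == f i]].

Lemma arc_stabP f k g :
  reflect (g \in G /\ forall i, (i <= k)%N -> g (f i) = f i) (g \in arc_stab f k).
Proof.
rewrite inE; apply: (iffP andP) => -[Gg H]; split=> //.
  by move=> i Hi; have /forallP/(_ (Ordinal (Hi : (i < k.+1)%N)))/eqP := H.
by apply/forallP=> i; rewrite H // -ltnS.
Qed.

(** Each further vertex strictly shrinks the pointwise stabiliser, since the prefix has another
    prolongation and [G] moves [f] to an arc using it. This bounds the lengths [s] for which [G] is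
    transitive on [s]-arcs. *)
Lemma arc_trans_bound s : (0 < s)%N -> arc_trans s -> forall f, is_arc s f ->
  forall k, (k <= s)%N -> (#|arc_stab f k| + k <= #|G|)%N.
Proof.
move=> s0 Ts f fA; elim=> [|k IH] Hk.
  by rewrite addn0; apply: subset_leq_card; apply/subsetP=> g; rewrite inE => /andP[].
apply: leq_trans (IH (ltnW Hk)); rewrite addnS -addSn leq_add2r.
apply: proper_card; rewrite properE; apply/andP; split.
  apply/subsetP=> g /arc_stabP[Gg H]; apply/arc_stabP; split=> // i Hi.
  by apply: H; rewrite ltnW.
have [w fw [wf wk]] : exists2 w, e (f k) w & w != f k.+1 /\ forall t, k = t.+1 -> f t != w.
  case: k => [|k] in IH Hk *.
    by have [w ? ?] := cubic_other (fA.1 0 Hk); exists w.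
  have f1 : e (f k.+1) (f k) by rewrite eS; apply: fA.1; lia.
  have [c [? ? ? _]] := cubic_third f1 (fA.1 _ Hk) (fA.2 _ Hk).
  by exists c => //; split=> // t [<-]; rewrite eq_sym.
have aA : is_arc k.+1 (snoc k f w).
  by apply: is_arc_snoc => //; apply: is_arc_prefix fA; lia.
have [a' [aA' Ea]] : exists a', is_arc s a' /\ forall i, (i <= k.+1)%N -> a' i = snoc k f w i.
  rewrite -(subnK Hk); elim: (s - _)%N => [|m [a' [aA' Ea]]]; first by exists (snoc k f w).
  have [|a'' [? E]] := is_arc_extend _ aA'; first by lia.
  by exists a''; split=> // i Hi; rewrite E ?Ea //; lia.
have [g Gg gf] := Ts _ _ fA aA'.
apply/subsetPn; exists g.
  apply/arc_stabP; split=> // i Hi; rewrite gf; last by lia.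
  by rewrite Ea ?/snoc ?Hi //; lia.
apply/arc_stabP=> -[_ /(_ k.+1 (leqnn _))]; rewrite gf // Ea // /snoc ltnn => wE.
by rewrite wE eqxx in wf.
Qed.

Hypothesis T1 : arc_trans 1%N.
Variables (u0 w0 : V).
Hypothesis uw0 : e u0 w0.

Lemma arc_regular_exists : exists s, [/\ (0 < s)%N, arc_trans s & arc_free s].
Proof.
have [s [s0 Ts nT]] : exists s, [/\ (0 < s)%N, arc_trans s & ~ arc_trans s.+1].
  apply: NNPP => H.
  have Tall s : arc_trans s.+1.
    by elim: s => // s IH; apply: NNPP => nT; apply: H; exists s.+1.
  (* An arc longer than the order of [G] violates the bound. *)
  have [f [fA _ _]] := long_arc (s := #|G|.+1) uw0 isT.
  have := arc_trans_bound (ltn0Sn _) (Tall _) fA (leqnn _).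
  lia.
by exists s; split=> //; apply: arc_free_max.
Qed.

End Cubic.

Ltac nlia :=
  repeat match goal with
  | H : is_true (_ \in _) |- _ => clear H
  | H : is_true (~~ (_ \in _)) |- _ => clear H
  | H : is_true (_ \subset _) |- _ => clear H
  end; lia.

(** * Arc-transitive groups on connected graphs *)

Section ArcTransitive.
Variables (V : finType) (e : rel V).
Hypotheses (eS : symmetric e) (eC : connected_graph e).
Variable G : {group {perm V}}.
Hypothesis GA : G \subset GAut e.
Hypothesis T1 : arc_trans e G 1%N.

Lemma arc1 x y : e x y -> is_arc e 1 (fun i => if i is 0 then x else y).
Proof. by move=> xy; split=> -[]. Qed.

Lemma nbr_trans u w z : e u w -> e u z -> exists h, [/\ h \in G, h u = u & h w = z].
Proof.
move=> uw uz.
have [h Gh H] := T1 (arc1 uw) (arc1 uz).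
by exists h; split=> //; [exact: (H 0)|exact: (H 1%N)].
Qed.

Lemma vertex_trans x y : exists2 g, g \in G & g x = y.
Proof.
pose Q z := exists2 g, g \in G & g x = z.
apply: (@graph_connected_ind _ _ eC Q x) => [|z w [g Gg gx] zw].
  by exists 1; rewrite ?group1 ?perm1.
have [h Gh H] := T1 (arc1 zw) (arc1 (etrans (eS w z) zw)).
by exists (g * h); rewrite ?groupM // permM gx; apply: (H 0).
Qed.

(** The property of fixing a vertex and centralising its stabiliser passes from the two ends of an
    edge to all their neighbours, by conjugation with elements of a stabiliser that [y] centralises.
    So [y] fixes every vertex. *)
Lemma edge_stabs_centraliser y u w : y \in G -> e u w -> y u = u -> y w = w ->
  (forall h, h \in G -> h u = u -> commute y h) ->
  (forall h, h \in G -> h w = w -> commute y h) -> y = 1.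
Proof.
move=> Gy uw yu yw cu cw.
pose P u := y u = u /\ forall h, h \in G -> h u = u -> commute y h.
(* The induction carries an edge: a new neighbour of [u] is reached from a neighbour for which [P]
   is already known. *)
pose Q x := P x /\ exists2 z, e x z & P z.
suff Qall : forall x, Q x by apply/permP=> z; rewrite perm1; have [[]] := Qall z.
apply: (@graph_connected_ind _ _ eC Q u); first by split; [split|exists w].
move=> {uw yu yw cu cw}u x {w}[[yu cu] [w uw [yw cw]]] ux.
split; last by exists u; rewrite 1?eS.
have [h [Gh hu hw]] := nbr_trans uw ux.
have yh : y * h = h * y by apply: cu.
split=> [|k Gk kx]; first by rewrite -hw -permM -yh permM yw.
have : commute y (k ^ h^-1).
  apply: cw; first by rewrite groupJ ?groupV.
  by rewrite conjgE invgK !permM hw kx -hw permK.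
move=> /(f_equal (fun z => z ^ h)); rewrite /= (conjMg y) (conjMg _ y) conjgKV.
have -> : y ^ h = y by rewrite conjgE yh mulKg.
by [].
Qed.

(** The stabiliser of [u] and [t] generate [G], because their products already carry [u] to every
    vertex. *)
Lemma parity_eq0 chi u t : parity G chi -> t \in G -> e u (t u) -> chi t = false ->
  (forall g, g \in G -> g u = u -> chi g = false) -> forall g, g \in G -> chi g = false.
Proof.
move=> chiM Gt ut chit chiu g Gg.
pose Q x := exists2 m, m \in G /\ chi m = false & m u = x.
have [m [Gm cm] mu] : Q (g u).
  apply: (@graph_connected_ind _ _ eC Q u) => [|x y [m [Gm cm] mu] xy].
    by exists 1; rewrite ?perm1 ?group1 ?(parity1 chiM).
  have [|h [Gh hu hy]] := @nbr_trans u (t u) (m^-1 y) ut.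
    by rewrite -(edgeG GA _ _ Gm) permKV mu.
  (* This sends [u] to [t u], then to the preimage of [y] under [m], then to [y]. *)
  exists (t * h * m); last by rewrite !permM hy permKV.
  by rewrite !chiM ?groupM // chit cm (chiu h).
have : chi (g * m^-1) = false.
  by apply: chiu; rewrite ?groupM ?groupV // permM -mu permK.
by rewrite chiM ?groupV // (parityV chiM) // cm addbF.
Qed.

End ArcTransitive.

(** * Stabilisers along a shunt *)

Section Shunt.
Variables (V : finType) (e : rel V).
Hypotheses (eS : symmetric e) (eC : connected_graph e) (e3 : cubic_graph e).
Variable G : {group {perm V}}.
Hypothesis GA : G \subset GAut e.
Variable s : nat.
Hypotheses (s0 : (0 < s)%N) (Ts : arc_trans e G s) (Fs : arc_free e G s).

(** [t] advances an [s]-arc one step along an arc of length [s.+1]; the images of the first vertex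
    under powers of [t] then form a walk without backtracking. *)
Lemma shunt_exists u w : e u w -> exists v t,
  [/\ t \in G, forall i, t (v i) = v i.+1, forall i, e (v i) (v i.+1)
    & forall i, v i != v i.+2 :> V].
Proof.
move=> uw; have [f [fA _ _]] := long_arc eS e3 uw (ltn0Sn s).
have [t Gt tf] := Ts (is_arc_prefix (leqnSn s) fA) (is_arc_drop (t := 1%N) fA).
exists (fun i => (t ^+ i) (f 0)), t; split=> // [i|i|i].
- by rewrite -permM -expgSr.
- by rewrite expgS permM tf // (edgeG GA) ?groupX //; apply: fA.1.
- rewrite expgS expgS !permM tf // tf //= (inj_eq perm_inj).
  exact: fA.2.
Qed.

(** Here [x] carries the arc [v 0, ..., v s] to an arc that differs from it only in the last
    vertex. *)
Lemma swap_exists v : (forall i, e (v i) (v i.+1)) -> (forall i, v i != v i.+2) ->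
  exists x : {perm V}, [/\ x \in G, forall i, (i < s)%N -> x (v i) = v i & x (v s) != v s].
Proof.
move=> vE vN; case: s s0 Ts => // r _ Tr.
have [w uw [wn wN]] : exists2 w, e (v r) w & w != v r.+1 /\ forall t, r = t.+1 -> v t != w.
  case: r => [|r] in Tr *.
    by have [w ? ?] := cubic_other e3 (vE 0); exists w.
  have f1 : e (v r.+1) (v r) by rewrite eS.
  have [c [? ? ? _]] := cubic_third e3 f1 (vE _) (vN _).
  by exists c => //; split=> // t [<-]; rewrite eq_sym.
have vA : is_arc e r.+1 v by split.
have aA : is_arc e r.+1 (snoc r v w).
  by apply: is_arc_snoc => //; split.
have [x Gx xv] := Tr _ _ vA aA; exists x; split=> // [i Hi|].
  by rewrite xv /snoc; [rewrite -ltnS Hi|exact: ltnW].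
by rewrite xv // /snoc ltnn.
Qed.

End Shunt.

Section Path.
Variables (V : finType) (e : rel V).
Hypotheses (eS : symmetric e) (eC : connected_graph e) (e3 : cubic_graph e).
Variable G : {group {perm V}}.
Hypothesis GA : G \subset GAut e.
Variable s : nat.
Hypotheses (s2 : (1 < s)%N) (Fs : arc_free e G s).
Variables (v : nat -> V) (t x0 : {perm V}).
Hypotheses (Gt : t \in G) (tv : forall i, t (v i) = v i.+1).
Hypotheses (vE : forall i, e (v i) (v i.+1)) (vN : forall i, v i != v i.+2).
Hypotheses (Gx0 : x0 \in G) (x0v : forall i, (i < s)%N -> x0 (v i) = v i).
Hypothesis x0s : x0 (v s) != v s.

(* [X i] fixes v_i, ..., v_(i+s-1) and moves v_(i+s), and [F i j] is the stabiliser of the arc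
   v_j, ..., v_(i+s-1); for j <= i + s - 2 it is generated by [X i], ..., [X j] and has
   order 2 ^ (j - i + 1). *)
Definition X i := x0 ^ (t ^+ i).

Definition F i j := [set g in G | [forall k : 'I_(i + s), (j <= k)%N ==> (g (v k) == v k)]].

Lemma FP i j g :
  reflect (g \in G /\ forall k, (j <= k < i + s)%N -> g (v k) = v k) (g \in F i j).
Proof.
rewrite inE; apply: (iffP andP) => -[Gg H]; split=> //.
  move=> k /andP[jk Hk]; have /forallP/(_ (Ordinal Hk))/implyP := H.
  by move=> /(_ jk)/eqP.
by apply/forallP=> k; apply/implyP=> jk; rewrite H // jk /=.
Qed.

Lemma F_group_set i j : group_set (F i j).
Proof.
apply/group_setP; split; first by apply/FP; split=> // k _; rewrite perm1.
move=> g h /FP[Gg gv] /FP[Gh hv]; apply/FP; split; first exact: groupM.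
by move=> k Hk; rewrite permM gv // hv.
Qed.
Canonical F_group i j := Group (F_group_set i j).

Lemma GX i : X i \in G. Proof. by rewrite groupJ ?groupX. Qed.

Lemma tXv i k : (t ^+ i) (v k) = v (i + k).
Proof.
elim: i k => [|i IH] k; first by rewrite expg0 perm1.
by rewrite expgS permM tv IH addnS.
Qed.

Lemma XJ i j : X i ^ (t ^+ j) = X (i + j).
Proof. by rewrite /X -conjgM -expgD. Qed.

Lemma FJ i j k g : (g ^ (t ^+ k) \in F (i + k) (j + k)) = (g \in F i j).
Proof.
apply/FP/FP=> -[]; rewrite groupJr ?groupX // => Gg H; split=> // m Hm.
  apply: (@perm_inj _ (t ^+ k)); rewrite -permJ tXv H //; nlia.
have -> : m = (k + (m - k))%N by nlia.
rewrite -tXv permJ H //; nlia.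
Qed.

Lemma Xv i k : (i <= k < i + s)%N -> X i (v k) = v k.
Proof.
move=> Hk; have -> : k = (i + (k - i))%N by nlia.
by rewrite -tXv permJ x0v //; nlia.
Qed.

Lemma Xs i : X i (v (i + s)) != v (i + s).
Proof. by rewrite -tXv permJ (inj_eq perm_inj). Qed.

Lemma F_arc1 i g : g \in G -> (forall k, (i <= k <= i + s)%N -> g (v k) = v k) -> g = 1.
Proof.
move=> Gg gv; apply: (Fs (f := fun k => v (i + k))) => //.
  by split=> k _; rewrite !addnS.
by move=> k Hk; apply: gv; nlia.
Qed.

Lemma F_empty i j g : (j < i)%N -> g \in F i j -> g = 1.
Proof.
by move=> ji /FP[Gg H]; apply: (@F_arc1 j) => // k Hk; apply: H; nlia.
Qed.

Lemma Xpred i : X i.+1 (v i) != v i.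
Proof.
apply/eqP=> Ei; have X1 : X i.+1 = 1.
  apply: (@F_arc1 i) => [|k Hk]; first exact: GX.
  case: (eqVneq k i) => [->//|ki]; apply: Xv; nlia.
by have := Xs i.+1; rewrite X1 perm1 eqxx.
Qed.

Lemma XF k i j : (i <= k <= j)%N -> X k \in F i j.
Proof. by move=> Hk; apply/FP; split=> [|m Hm]; [exact: GX|apply: Xv; nlia]. Qed.

Lemma F_sub i j i' j' g : (i' <= i)%N -> (j <= j')%N -> g \in F i j -> g \in F i' j'.
Proof. by move=> Hi Hj /FP[Gg H]; apply/FP; split=> // k Hk; apply: H; nlia. Qed.

(** The two bounds say that the intervals of fixed indices overlap or touch, so that their union is
    again an interval. *)
Lemma FI i j i' j' g : (j <= i' + s)%N -> (j' <= i + s)%N ->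
  g \in F i j -> g \in F i' j' -> g \in F (maxn i i') (minn j j').
Proof.
move=> A B /FP[Gg H] /FP[_ H']; apply/FP; split=> // k Hk.
case: (boolP (j <= k < i + s)%N) => K; first exact: H.
by apply: H'; nlia.
Qed.

Lemma GAg g : g \in G -> g \in GAut e. Proof. exact: (subsetP GA). Qed.

Lemma vE' i : e (v i.+1) (v i). Proof. by rewrite eS. Qed.

(** The fixed arc contains the edge from [v (i + s - 2)] to [v (i + s - 1)], which [X i] fixes too.
    If [g] moves [v (i + s)], both swap the same two neighbours, so [X i] brings that vertex
    back. *)
Lemma F_lo i j g : (i <= j)%N && (j.+1 < i + s)%N -> g \in F i j ->
  g \in F i.+1 j \/ g * X i \in F i.+1 j.
Proof.
move=> /andP[ij Hj] /FP[Gg gv]; case: (eqVneq (g (v (i + s))) (v (i + s))) => gs.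
  left; apply/FP; split=> // k Hk.
  by case: (eqVneq k (i + s)) => [->//|ki]; apply: gv; nlia.
right; apply/FP; split=> [|k Hk]; first by rewrite groupM ?GX.
rewrite permM; case: (eqVneq k (i + s)) => [->|ki].
  have [r Er] : exists r, (i + s = r.+2)%N by exists (i + s - 2)%N; nlia.
  have Xi m : (i <= m < i + s)%N -> X i (v m) = v m by apply: Xv.
  have Xis := Xs i.
  rewrite Er in gs gv Xi Xis Hj *.
  apply: (aut_swapK e3 (GAg Gg) (u := v r.+1) (a := v r)) => //.
  - by apply: gv; nlia.
  - by apply: gv; nlia.
  - exact: vE'.
  - exact: (GAg (GX i)).
  - by apply: Xi; nlia.
  - by apply: Xi; nlia.
rewrite gv; last by nlia.
by apply: Xv; nlia.
Qed.

(** The mirror image of [F_lo], at the initial end of the arc, where [X j.+1] moves [v j]. *)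
Lemma F_hi i j g : (i <= j.+1)%N -> (j.+2 < i + s)%N -> g \in F i j.+1 ->
  g \in F i j \/ g * X j.+1 \in F i j.
Proof.
move=> ij Hj /FP[Gg gv]; case: (eqVneq (g (v j)) (v j)) => gs.
  left; apply/FP; split=> // k Hk.
  by case: (eqVneq k j) => [->//|ki]; apply: gv; nlia.
right; apply/FP; split=> [|k Hk]; first by rewrite groupM ?GX.
rewrite permM; case: (eqVneq k j) => [->|ki].
  apply: (aut_swapK e3 (GAg Gg) (u := v j.+1) (a := v j.+2)) => //.
  - by apply: gv; nlia.
  - by apply: gv; nlia.
  - exact: (GAg (GX _)).
  - by apply: Xv; nlia.
  - by apply: Xv; nlia.
  - exact: vE'.
  - by rewrite eq_sym.
  - exact: Xpred.
rewrite gv; last by nlia.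
by apply: Xv; nlia.
Qed.

Lemma XX i : X i * X i = 1.
Proof.
have [//||H|H] := @F_lo i i (X i); first by nlia.
- by apply: XF; nlia.
- by case/FP: H => _ /(_ (i + s)%N) H; have := Xs i; rewrite H ?eqxx //; nlia.
- by apply: F_empty H.
Qed.

Lemma XV i : (X i)^-1 = X i.
Proof. by apply: (mulgI (X i)); rewrite mulgV XX. Qed.

(** Generation of [F i j] by [X i, ..., X j], in the form of an induction principle: [F_lo] peels
    off one generator at a time. *)
Lemma F_ind (P : {perm V} -> Prop) i j : (j.+1 < i + s)%N -> P 1 ->
  (forall g k, (i <= k <= j)%N -> P g -> P (g * X k)) -> forall g, g \in F i j -> P g.
Proof.
move=> Hj P1 PX g; move En : (j.+1 - i)%N => n.
elim: n i Hj PX En g => [|n IH] i Hj PX En g Fg.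
  by rewrite (F_empty _ Fg) //; nlia.
have IH' h : h \in F i.+1 j -> P h.
  apply: IH => [||]; try nlia.
  by move=> h' k Hk; apply: PX; nlia.
have Hj' : (i <= j)%N && (j.+1 < i + s)%N by nlia.
have [/IH'//|H] := F_lo Hj' Fg.
by rewrite -[g]mulg1 -(XX i) mulgA; apply: PX; [nlia|apply: IH'].
Qed.

Lemma F_commute i j y : (j.+1 < i + s)%N ->
  (forall k, (i <= k <= j)%N -> commute y (X k)) -> forall g, g \in F i j -> commute y g.
Proof.
move=> Hj H; apply: F_ind => //; first exact: commute1.
by move=> g k Hk gy; apply: commuteM => //; apply: H.
Qed.

Lemma commuteX a b : commute (X a) (X (a + b)) <-> commute x0 (X b).
Proof.
rewrite (_ : x0 = X 0); last by rewrite /X expg0 conjg1.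
rewrite -[in X (a + b)](addnC b) -XJ -{1}(add0n a) -XJ /commute -!conjMg.
by split=> [/conjg_inj|->].
Qed.

Lemma X0 : X 0 = x0. Proof. by rewrite /X expg0 conjg1. Qed.

Lemma card_F i j : (j.+1 < i + s)%N -> (i <= j)%N -> #|F i j| = (#|F i.+1 j| * 2)%N.
Proof.
move=> Hj ij.
have -> : F i j = F i.+1 j :|: F i.+1 j :* X i.
  apply/setP=> g; rewrite in_setU mem_rcoset XV; apply/idP/idP.
    have Hj' : (i <= j)%N && (j.+1 < i + s)%N by nlia.
    by move=> /(F_lo Hj')[]->; rewrite ?orbT.
  case/orP=> [|H]; first by apply: F_sub.
  rewrite -[g]mulg1 -(XX i) mulgA groupM //; last by apply: XF; nlia.
  by apply: F_sub H.
rewrite cardsU card_rcoset (_ : _ :&: _ = set0) ?cards0 ?subn0; first by rewrite addnn muln2.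
apply/setP=> g; rewrite in_setI in_set0 mem_rcoset XV; apply/negP=> /andP[/FP[_ A] /FP[_ B]].
have := Xs i; rewrite -(A (i + s)%N); last by nlia.
by rewrite -permM A ?B ?eqxx //; nlia.
Qed.

Lemma card_FE i j : (j.+1 < i + s)%N -> #|F i j| = (2 ^ (j.+1 - i))%N.
Proof.
move En : (j.+1 - i)%N => n; elim: n i En => [|n IH] i En Hj.
  rewrite (_ : F i j = 1) ?cards1 //; apply/trivgP/subsetP=> g /F_empty->; rewrite ?group1 //.
  nlia.
rewrite card_F //; last by nlia.
by rewrite IH ?expnSr //; nlia.
Qed.

Lemma pgroup_F i j : (j.+1 < i + s)%N -> 2.-group (F i j).
Proof. by move=> Hj; rewrite /pgroup card_FE // pnatX. Qed.

Lemma F_half_normal i j i' j' : (i <= i')%N -> (j' <= j)%N -> (j.+1 < i + s)%N ->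
  (j'.+1 < i' + s)%N -> (j.+1 - i = (j'.+1 - i').+1)%N -> F i' j' <| F i j.
Proof.
move=> ii jj Hj Hj' E.
have sub : F i' j' \subset F i j by apply/subsetP=> g; apply: F_sub.
apply: index2_normal => //; rewrite -divgS //= !card_FE // E expnS mulnK //.
by rewrite expn_gt0.
Qed.

Lemma F_singleton i g : g \in F i i -> g = 1 \/ g = X i.
Proof.
move=> Fg; have [||/F_empty->|/F_empty E] := @F_lo i i g => //; try nlia; first by left.
by right; rewrite -[g]mulg1 -(XX i) mulgA E ?mul1g.
Qed.

(* [X i] and [X (i + s - 1)] act transitively on the neighbours of [v (i + s - 1)]. *)
Lemma vertex_stab_ind (P : {perm V} -> Prop) i r : (i + s = r.+2)%N -> P 1 ->
  (forall g k, (i <= k <= r.+1)%N -> P g -> P (g * X k)) ->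
  forall g, g \in G -> g (v r.+1) = v r.+1 -> P g.
Proof.
move=> Er P1 PX.
have Xi k : (i <= k < r.+2)%N -> X i (v k) = v k by rewrite -Er; apply: Xv.
have Xr k : (r.+1 <= k <= r.+2)%N -> X r.+1 (v k) = v k by move=> Hk; apply: Xv; nlia.
have ir : (i <= r)%N by nlia.
have Xib : X i (v r.+2) != v r.+2 by rewrite -Er Xs.
(* Three cases for the image of [v r]: it is [v r], the third neighbour [c], or [v r.+2].
   Multiplication by [X r.+1] reduces the second to the first, and by [X i] the third to the
   second. *)
have A g : g \in G -> g (v r.+1) = v r.+1 -> g (v r) = v r -> P g.
  move=> Gg gu ga; apply: (@F_ind P i r) => //; first by nlia.
    by move=> h k Hk; apply: PX; nlia.
  apply/FP; split=> // k; rewrite Er => Hk.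
  by have [->|->] : k = r \/ k = r.+1 by nlia.
have mulK g k : (i <= k <= r.+1)%N -> P (g * X k) -> P g.
  by move=> Hk Pg; rewrite -[g]mulg1 -(XX k) mulgA; apply: PX.
have [c [uc ca cb E]] := cubic_third e3 (vE' r) (vE r.+1) (vN r).
have nb g z : g \in G -> g (v r.+1) = v r.+1 -> e (v r.+1) z -> e (v r.+1) (g z).
  by move=> Gg gu uz; rewrite -{1}gu (edgeG GA).
have Xu k : (i <= k <= r.+1)%N -> X k (v r.+1) = v r.+1.
  by move=> Hk; apply: Xv; nlia.
have {Er} [Hi Hr] : (i <= r.+1)%N /\ (i <= r < r.+2)%N by nlia.
have ir1 : (i <= i <= r.+1)%N by rewrite leqnn.
have ir2 : (i <= r.+1 <= r.+1)%N by rewrite leqnn Hi.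
have ab := vN r.
have Xib' : X i (v r.+2) = c.
  case: (E _ (nb _ _ (GX i) (Xu i ir1) (vE r.+1))) => // Eb.
    by move: ab; rewrite -(inj_eq (@perm_inj _ (X i))) Xi // Eb eqxx.
  by rewrite Eb eqxx in Xib.
have Xic : X i c = v r.+2 by rewrite -Xib' -permM XX perm1.
have Xrb : X r.+1 (v r.+2) = v r.+2 by apply: Xr; rewrite leqnSn leqnn.
have Xra : X r.+1 (v r) = c.
  case: (E _ (nb _ _ (GX r.+1) (Xu r.+1 ir2) (vE' r))) => // Eb.
    by have := Xpred r; rewrite Eb eqxx.
  by move: ab; rewrite -(inj_eq (@perm_inj _ (X r.+1))) Xrb ?Eb ?eqxx.
have Xrc : X r.+1 c = v r by rewrite -Xra -permM XX perm1.
have C g : g \in G -> g (v r.+1) = v r.+1 -> g (v r) = c -> P g.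
  move=> Gg gu ga; apply: (mulK _ r.+1) => //.
  by apply: A; rewrite ?(groupM Gg (GX _)) ?(permM g) ?gu ?Xu ?ga ?Xrc.
move=> g Gg gu; case: (E _ (nb _ _ Gg gu (vE' r))) => ga; [exact: A| |exact: C].
apply: (mulK _ i) => //.
by apply: C; rewrite ?(groupM Gg (GX _)) ?(permM g) ?gu ?Xu ?ga.
Qed.

Hypothesis T1 : arc_trans e G 1%N.

(** Otherwise [x0] would fix both [v (s - 2)] and its image under [X (s - 1)], two distinct
    neighbours of [v (s - 1)], and hence also the neighbour [v s]. *)
Lemma X_ncommute_last : ~ commute x0 (X s.-1).
Proof.
have [r Er] : exists r, s = r.+2 by exists (s - 2)%N; nlia.
rewrite (_ : s.-1 = r.+1) ?Er // => /(f_equal (fun g : {perm V} => g (v r))).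
rewrite (permM x0) (permM (X r.+1)) x0v ?Er; last by nlia.
have Xu : X r.+1 (v r.+1) = v r.+1 by apply: Xv; nlia.
move=> /esym H; move: x0s; rewrite Er => /eqP; apply.
apply: (aut_fix_nbrs e3 (GAg Gx0) _ _ (vE' r) _ _ H (vE r.+1)).
- by apply: x0v; nlia.
- by apply: x0v; nlia.
- by rewrite -{1}Xu (edgeG GA) ?GX ?vE'.
- by rewrite eq_sym Xpred.
Qed.

(** * Tutte's commutator calculus *)

Section Tutte.
(* [lam] is the least distance at which two of the [X i] do not commute. *)
Variables (lam : nat) (chi : {perm V} -> bool).
Hypotheses (lamC : forall k, (k < lam)%N -> commute x0 (X k))
  (lamN : ~ commute x0 (X lam)).
Hypotheses (chiM : parity G chi) (chi0 : chi x0).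

Lemma chiX i : chi (X i) = true.
Proof. by rewrite (parityJ chiM) ?groupX. Qed.

Lemma X_commute a b : (a < b + lam)%N -> (b < a + lam)%N -> commute (X a) (X b).
Proof.
move=> ab ba; case: (leqP a b) => H.
  by rewrite -(subnKC H); apply/commuteX; apply: lamC; nlia.
apply: commute_sym; rewrite -(subnKC (ltnW H)); apply/commuteX; apply: lamC; nlia.
Qed.

Lemma X_ncommute a : ~ commute (X a) (X (a + lam)).
Proof. by move/commuteX. Qed.

Lemma commg_mulc (g h z : {perm V}) : commute z g -> commute z h -> [~ g * z, h] = [~ g, h].
Proof.
move=> zg zh; rewrite commMgJ (_ : [~ z, h] = 1) ?mulg1; last exact/eqP/commgP.
rewrite conjgE -[RHS](mulKg z); congr (_ * _).
by apply: commute_sym; do 3?[apply: commuteM]; rewrite //; apply: commuteV.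
Qed.

(* If [F i j = <g> * F i.+1 j] with [g] central, the commutators of [F i j] are those of
   [F i.+1 j], the conjugate of [F i j.-1] by [t]; hence the set of commutators of [F i j.-1]
   is invariant under [t]. *)
Lemma central_lo i j g : (i + lam < j)%N -> (j.+1 < i + s)%N -> g \in F i j ->
  (forall h, h \in F i j -> commute g h) -> g \in F i.+1 j.
Proof.
case: j => // j ij js Fg gC; apply/idPn => gN.
have js' : (i <= j.+1)%N && (j.+2 < i + s)%N by nlia.
have Bg : g * X i \in F i.+1 j.+1 by case: (F_lo js' Fg) => // gB; rewrite gB in gN.
(* Modulo the central element [g], every [u] may be taken from [F i.+1 j.+1]. *)
have dec u : u \in F i j -> exists u', exists2 z, u = u' * z &
    [/\ u' \in F i.+1 j.+1, u' \in F i j.+1 & forall h, h \in F i j.+1 -> commute z h].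
  move=> Fu; have {}Fu : u \in F i j.+1 by apply: F_sub Fu.
  case: (F_lo js' Fu) => Bu.
    by exists u, 1; rewrite ?mulg1 //; split=> // h _; apply/commute_sym/commute1.
  exists (u * g^-1), g; rewrite ?mulgKV //; split=> //; last by rewrite groupM ?groupV.
  have -> : u * g^-1 = (u * X i) * (g * X i)^-1 by rewrite invMg mulgA mulgK.
  by rewrite groupM ?groupV.
pose D d := exists u w, [/\ u \in F i j, w \in F i j & d = [~ u, w]].
have Dt d : D d -> exists2 d1, D d1 & d = d1 ^ t.
  move=> [u [w [Fu Fw ->]]].
  have [u' [z -> [Bu Au zC]]] := dec u Fu.
  have [w' [z' Ew [Bw Aw z'C]]] := dec w Fw.
  have Aw0 : w \in F i j.+1 by apply: F_sub Fw.
  rewrite commg_mulc; [|exact: zC|exact: zC].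
  have -> : [~ u', w] = [~ u', w'].
    by rewrite -invg_comm Ew commg_mulc ?invg_comm //; apply: z'C.
  exists [~ u' ^ t^-1, w' ^ t^-1]; last by rewrite -conjRg conjgKV.
  exists (u' ^ t^-1), (w' ^ t^-1); split=> //.
  - by rewrite -(FJ i j 1%N) !addn1 expg1 conjgKV.
  - by rewrite -(FJ i j 1%N) !addn1 expg1 conjgKV.
have Dr d r : D d -> exists2 d1, D d1 & d = d1 ^ (t ^+ r).
  move=> Dd; elim: r => [|r [d1 /Dt[d2 Dd2 ->] ->]]; first by exists d; rewrite ?conjg1.
  by exists d2; rewrite // expgS conjgM.
(* This commutator is nontrivial. Being, for every [r], the conjugate by [t ^+ r] of an element of
   [F i j], it fixes every vertex from [v (i + s - 1)] on, a contradiction. *)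
have Dd : D [~ X i, X (i + lam)].
  by exists (X i), (X (i + lam)); split=> //; apply: XF; nlia.
apply: (X_ncommute (a := i)); apply/commgP/eqP/(@F_arc1 (i + s).-1).
  by rewrite groupR ?GX.
move=> k /andP[/subnK <- _]; move: (k - _)%N => r.
have [d1 [u [w [Fu Fw Ed]]] ->] := Dr _ r Dd.
rewrite -tXv permJ; have /FP[_ ->] // : d1 \in F i j by rewrite Ed groupR.
nlia.
Qed.

Lemma F_span n i j g : (j - i < n)%N -> (j.+1 < i + s)%N -> g \in F i j -> g != 1 ->
  exists a b, [/\ (i <= a)%N, (a <= b)%N, (b <= j)%N, g \in F a b &
    g \notin F a.+1 b /\ forall b', b = b'.+1 -> g \notin F a b'].
Proof.
elim: n i j => // n IH i j Hn Hj Fg g1.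
have ij : (i <= j)%N by rewrite leqNgt; apply: contra g1 => H; rewrite (F_empty H Fg).
case: (boolP (g \in F i.+1 j)) => [F1|N1].
  have ij1 : (i < j)%N by rewrite ltnNge; apply: contra g1 => H; rewrite (F_empty _ F1).
  have [|||a [b [? ? ? ? ?]]] := IH _ _ _ _ F1; try by [|nlia].
  by exists a, b; split=> //; nlia.
case: (boolP [exists b : 'I_j, (j == b.+1) && (g \in F i b)]) => [/existsP[b]|N2].
  move=> /andP[/eqP jb Fb].
  have ib : (i <= b)%N by rewrite leqNgt; apply: contra g1 => H; rewrite (F_empty H Fb).
  have [|||a [b' [? ? ? ? ?]]] := IH _ _ _ _ Fb; try by [|nlia].
  by exists a, b'; split=> //; nlia.
exists i, j; split=> //; split=> // b' Eb; apply: contra N2 => Fb.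
by subst j; apply/existsP; exists ord_max; rewrite eqxx.
Qed.

(** A generator of [F i j] at distance [lam] from an end of the span of [g] would commute with [g]
    and with all other generators of the span, hence with the end generator, against the choice of
    [lam]. At the lower end this treats [j = a + lam]; larger [j] are excluded by [central_lo]. *)
Lemma central_span i j g : (j.+1 < i + s)%N -> g \in F i j -> g != 1 ->
  (forall h, h \in F i j -> commute g h) ->
  exists a b, [/\ (a <= b)%N, (j < a + lam)%N, (b < i + lam)%N & g \in F a b].
Proof.
move=> Hj Fg g1 gC.
have [a [b [ia ab bj Fab [nlo nhi]]]] := F_span (ltnSn _) Hj Fg g1.
have Hlo : (a <= b)%N && (b.+1 < a + s)%N by nlia.
have lo : (j < a + lam)%N.
  rewrite ltnNge; apply/negP=> jl; case: (ltnP (a + lam) j) => Hl.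
    have Fa : g \in F a.+1 j.
      apply: central_lo => //; first by nlia.
        by apply: F_sub Fab.
      by move=> h Fh; apply: gC; apply: F_sub Fh.
    case/negP: nlo; have := FI _ _ Fab Fa.
    by rewrite (maxn_idPr (leqnSn a)) (minn_idPl bj); apply; nlia.
  have Ej : j = (a + lam)%N by nlia.
  case: (F_lo Hlo Fab) => H; first by rewrite H in nlo.
  have cH : commute (X (a + lam)) (g * X a).
    apply: (F_commute _ _ H) => [|k Hk]; first by nlia.
    by apply: X_commute; nlia.
  have cg : commute (X (a + lam)) g.
    by apply/commute_sym/gC; apply: XF; nlia.
  apply: (@X_ncommute a); apply: commute_sym; rewrite -(mulKg g (X a)).
  by apply: commuteM => //; apply: commuteV.
exists a, b; split=> //; rewrite ltnNge; apply/negP=> bl.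
have lam0 : (0 < lam)%N.
  by rewrite lt0n; apply/eqP=> l0; apply: lamN; rewrite l0 X0.
case: b => [|b] in ab bj Fab nlo nhi Hlo bl *; first by nlia.
case: (@F_hi a b g); [nlia|nlia|done|by move=> H; have := nhi b erefl; rewrite H|].
move=> H; pose c := (b.+1 - lam)%N.
have cb : (c + lam = b.+1)%N by rewrite /c; nlia.
have cH : commute (X c) (g * X b.+1).
  apply: (F_commute _ _ H) => [|k Hk]; first by nlia.
  by apply: X_commute; nlia.
have cg : commute (X c) g by apply/commute_sym/gC; apply: XF; nlia.
apply: (@X_ncommute c); rewrite cb -(mulKg g (X b.+1)).
by apply: commuteM => //; apply: commuteV.
Qed.

Lemma lam_lt : (lam < s)%N.
Proof.
by rewrite ltnNge; apply/negP=> sl; apply: X_ncommute_last; apply: lamC; nlia.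
Qed.

(** Otherwise [X lam.-1] commutes with all of [X 0, ..., X s], which generate the stabilisers of the
    adjacent vertices [v (s - 1)] and [v s]; it would be trivial. *)
Lemma lam_upper : (2 < s)%N -> (lam.*2 <= s.+1)%N.
Proof.
move=> s3; rewrite leqNgt; apply/negP=> sl; have ls := lam_lt.
have [r Er] : exists r, s = r.+2 by exists (s - 2)%N; nlia.
have X1 : X lam.-1 = 1; last by have := Xs lam.-1; rewrite X1 perm1 eqxx.
apply: (@edge_stabs_centraliser _ _ eS eC _ T1 _ (v r.+1) (v r.+2)); rewrite ?GX ?vE //.
- by apply: Xv; nlia.
- by apply: Xv; nlia.
- apply: (@vertex_stab_ind _ 0 r); [by rewrite Er|exact: commute1|].
  by move=> g k Hk gy; apply: commuteM => //; apply: X_commute; nlia.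
- apply: (@vertex_stab_ind _ 1%N r.+1); [by rewrite Er|exact: commute1|].
  by move=> g k Hk gy; apply: commuteM => //; apply: X_commute; nlia.
Qed.

(** The nontrivial 2-group [F 0 (s - 2)] has a nontrivial central element, and its span satisfies
    [s - 2 < a + lam] and [a <= b < lam]. *)
Lemma lam_lower : (s <= lam.*2)%N.
Proof.
have Hs : ((s - 2).+1 < 0 + s)%N by nlia.
have : 'Z(F 0 (s - 2)) != 1.
  apply/eqP=> /(trivg_center_pgroup (pgroup_F Hs)) /= F1.
  have : X 0 \in F 0 (s - 2) by apply: XF.
  by rewrite F1 => /set1P X1; have := Xs 0; rewrite X1 perm1 eqxx.
case/trivgPn=> g /centerP[Fg gC] g1.
by have [a [b []]] := central_span Hs Fg g1 gC; nlia.
Qed.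

(** The commutator lies in two subgroups of index 2 in [F i (i + lam)], each containing one of its
    two entries, and so in their intersection. *)
Lemma X_comm_F i : (lam.+1 < s)%N -> [~ X i, X (i + lam)] \in F i.+1 (i + lam).-1.
Proof.
have lam0 : (0 < lam)%N by have := lam_lower; nlia.
move=> ls; have := @FI i.+1 (i + lam) i (i + lam).-1 [~ X i, X (i + lam)].
rewrite (maxn_idPl (leqnSn i)) (minn_idPr (leq_pred _)); apply; try nlia.
- have /andP[_ /subsetP N] : F i.+1 (i + lam) <| F i (i + lam) by apply: F_half_normal; nlia.
  have XN : X i \in 'N(F i.+1 (i + lam)) by apply: N; apply: XF; nlia.
  have Fy : X (i + lam) \in F i.+1 (i + lam) by apply: XF; nlia.
  by rewrite commgEr groupM // (memJ_norm _ XN) groupV.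
- have /andP[_ /subsetP N] : F i (i + lam).-1 <| F i (i + lam) by apply: F_half_normal; nlia.
  have XN : X (i + lam) \in 'N(F i (i + lam).-1) by apply: N; apply: XF; nlia.
  have Fy : X i \in F i (i + lam).-1 by apply: XF; nlia.
  by rewrite commgEl groupM ?groupV // (memJ_norm _ XN).
Qed.

Section Center.
Variable r : nat.
Hypothesis Er : s = r.+2.

(** [F 1 r] fixes [v r], [v r.+1] and [v r.+2]: it is the kernel of the action of the stabiliser of
    [v r.+1] on the three neighbours. *)
Lemma kernelJ q h : h \in G -> h (v r.+1) = v r.+1 -> q \in F 1 r -> q ^ h \in F 1 r.
Proof.
move=> Gh hu /FP[Gq qv]; apply/FP; split=> [|k Hk]; first exact: groupJ.
have hV : h^-1 (v r.+1) = v r.+1 by rewrite -{1}hu permK.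
have uk : e (v r.+1) (v k) \/ v k = v r.+1.
  have [->|[->|->]] : k = r \/ k = r.+1 \/ k = r.+2 by nlia.
  - by left; apply: vE'.
  - by right.
  - by left; apply: vE.
rewrite conjgE !permM; case: uk => [uk|->]; last by rewrite hV qv ?hu //; nlia.
rewrite (aut_fix_nbrs e3 (GAg Gq) _ _ (vE' r) (vE r.+1) (vN r)) ?permKV //.
- by apply: qv; nlia.
- by apply: qv; nlia.
- by apply: qv; nlia.
- by rewrite -{1}hV (edgeG GA) ?groupV.
Qed.

Lemma center_kernelJ q h : h \in G -> h (v r.+1) = v r.+1 ->
  q \in 'Z(F 1 r) -> q ^ h \in 'Z(F 1 r).
Proof.
move=> Gh hu /centerP[Fq qC]; apply/centerP; split; first exact: kernelJ.
move=> y Fy; have : commute q (y ^ h^-1).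
  by apply: qC; apply: kernelJ; rewrite ?groupV // -{1}hu permK.
by move/(f_equal (fun z => z ^ h)); rewrite (conjMg q) (conjMg _ q) conjgKV.
Qed.

Lemma center_kernel_span g : g \in 'Z(F 1 r) -> g \in F (r.+1 - lam) lam.
Proof.
case: (eqVneq g 1) => [->|g1 /centerP[Fg gC]]; first by rewrite group1.
have Hr : (r.+1 < 1 + s)%N by nlia.
have [a [b [ab ra bl Fab]]] := central_span Hr Fg g1 gC.
by apply: F_sub Fab; nlia.
Qed.

Lemma X_center_kernel k : (0 < k <= r)%N -> (r < k + lam)%N -> (k <= lam)%N ->
  X k \in 'Z(F 1 r).
Proof.
move=> Hk rk kl; apply/centerP; split; first by apply: XF.
move=> y Fy; apply: (F_commute _ _ Fy) => [|l Hl]; first by nlia.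
by apply: X_commute; nlia.
Qed.

End Center.

(* The commutator [~ X 0, X lam] is nontrivial, even in the generators, and lies in the centre of
   the kernel of the action of a vertex stabiliser on the neighbours. *)
Lemma regularity_with_lam : s \in [:: 2; 3; 5].
Proof.
have [|s4] := leqP s 3; first by case: s s2 => [|[|[|[|]]]].
have lu := lam_upper (ltnW s4); have ll := lam_lower.
have [r Er] : exists r, s = r.+2 by exists (s - 2)%N; nlia.
set d := [~ X 0, X lam].
have d1 : d != 1 by apply/commgP; rewrite X0.
have chid : chi d = false by rewrite (parityR chiM) ?GX.
have dZ : d \in F (r.+1 - lam) lam.
  apply: (center_kernel_span Er).
  have Zl : X lam \in 'Z(F 1 r) by apply: X_center_kernel => //; nlia.
  rewrite /d commgEr groupM //; apply: center_kernelJ => //; [exact: GX| |by rewrite groupV].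
  by apply: Xv; nlia.
have dF : d \in F 1 lam.-1 by apply: (X_comm_F 0); nlia.
have dI : d \in F (r.+1 - lam) lam.-1.
  have := FI _ _ dZ dF; rewrite (maxn_idPl _) ?(minn_idPr (leq_pred _)); last by nlia.
  by apply; nlia.
(* [d] is nontrivial and even, whereas the only nontrivial element of [F k k] is the odd [X k]. *)
have odd_d k : d \in F k k -> False.
  case/F_singleton => E; first by rewrite E eqxx in d1.
  by move: chid; rewrite E chiX.
(* The bounds on [lam] leave [s = 2 lam] and [s = 2 lam - 1]. In the former case the interval for
   [d] shrinks to the single index [lam - 1]. *)
case: (eqVneq s lam.*2) => [E|E].
  by have := odd_d lam.-1; rewrite {1}(_ : lam.-1 = r.+1 - lam)%N; [move=> /(_ dI)|nlia].
have El : (r.+3 = lam.*2)%N by nlia.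
(* Now [a + lam = s - 1], so the shifted commutator still lies in the centre of the same kernel;
   shifting back gives a second interval for [d]. *)
set a := (lam - 2)%N.
have d2E : [~ X a, X (a + lam)] = d ^ (t ^+ a).
  by rewrite conjRg !XJ add0n addnC.
have d2F : d ^ (t ^+ a) \in F a.+1 (a + lam).-1 by rewrite -d2E; apply: X_comm_F; nlia.
have d2Z : d ^ (t ^+ a) \in F (r.+1 - lam) lam.
  apply: (center_kernel_span Er); rewrite -d2E.
  have Za : X a \in 'Z(F 1 r) by apply: X_center_kernel => //; nlia.
  rewrite commgEl groupM ?groupV //; apply: center_kernelJ => //; first exact: GX.
  by apply: Xv; nlia.
have d12 : d \in F 1 2.
  rewrite -(FJ 1 2 a) (_ : 1 + a = a.+1)%N // (_ : 2 + a = lam)%N; last by nlia.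
  have := FI _ _ d2F d2Z; rewrite (maxn_idPl _); last by nlia.
  by rewrite (minn_idPr _); [apply; nlia|nlia].
have [lam3|lam4] := leqP lam 3.
  by have -> : s = 5%N by nlia.
(* For [lam >= 4] the intervals from [lam - 2] to [lam - 1] and from 1 to 2 share at most the index
   2. *)
have d22 : d \in F 2 2.
  have := FI _ _ dI d12; rewrite (maxn_idPl _); last by nlia.
  rewrite (minn_idPr _); last by nlia.
  by move=> H; apply: F_sub (H _ _); nlia.
by case: (odd_d _ d22).
Qed.

End Tutte.

Lemma regularity chi : parity G chi -> chi x0 -> s \in [:: 2; 3; 5].
Proof.
move=> chiM chi0.
have exk : exists k, x0 * X k != X k * x0.
  by exists s.-1; apply/eqP; apply: X_ncommute_last.
case: (ex_minnP exk) => lam /eqP lamN lamC.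
apply: (regularity_with_lam (lam := lam)) chiM chi0 => // l ll.
by apply/eqP/negPn/negP => /lamC; rewrite leqNgt ll.
Qed.

(** Up to conjugacy there is one vertex stabiliser, and it is generated by conjugates of [x0]. *)
Lemma parity_stab0 chi : parity G chi -> chi x0 = false ->
  forall g u, g \in G -> g u = u -> chi g = false.
Proof.
move=> chiM chi0 g u Gg gu.
have [r Er] : exists r, s = r.+2 by exists (s - 2)%N; nlia.
have [h Gh hu] := vertex_trans eS eC T1 u (v r.+1).
pose P k := k \in G /\ chi k = false.
suff H : forall k, k \in G -> k (v r.+1) = v r.+1 -> P k.
  rewrite -(parityJ chiM Gg Gh); apply: (H _ _ _).2; first exact: groupJ.
  by rewrite -hu permJ gu.
apply: (@vertex_stab_ind P 0 r); [by rewrite Er|by split; rewrite ?(parity1 chiM)|].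
move=> k l _ [Gk ck]; split; first by rewrite groupM ?GX.
by rewrite chiM ?GX // ck (parityJ chiM) ?groupX.
Qed.

End Path.

(* For a complement H, the character [g \notin H] vanishes on all vertex stabilisers exactly when
   H is sectional, and H is transitive otherwise. *)
Definition stab0 (V : finType) (G : {set {perm V}}) (chi : {perm V} -> bool) : Prop :=
  forall g u, g \in G -> g u = u -> chi g = false.

(** * Characters of arc-transitive groups on cubic graphs *)

Section Structure.
Variables (V : finType) (e : rel V).
Hypotheses (eS : symmetric e) (eC : connected_graph e) (e3 : cubic_graph e).
Variable G : {group {perm V}}.
Hypotheses (GA : G \subset GAut e) (T1 : arc_trans e G 1%N).

(** An element fixing a vertex and a neighbour is trivial; any other element of the stabiliser
    rotates the three neighbours, so its cube is trivial and its character vanishes. *)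
Lemma parity_stab0_free1 chi : arc_free e G 1%N -> parity G chi -> stab0 G chi.
Proof.
move=> F1 chiM g u Gg gu.
have fix1 a k : e u a -> k \in G -> k u = u -> k a = a -> k = 1.
  by move=> ua Gk ku ka; apply: (F1 _ k (arc1 ua)) => // -[|[]].
have [a ua] : exists a, e u a.
  have /card_gt0P[a] : (0 < #|[set y | e u y]|)%N by rewrite e3.
  by rewrite inE; exists a.
case: (eqVneq (g a) a) => [ga|ga]; first by rewrite (fix1 a g) ?(parity1 chiM).
have gE z : e u z -> e u (g z) by move=> uz; rewrite -{1}gu (edgeG GA).
have ag : a != g a by rewrite eq_sym.
have [c [uc ca cb E]] := cubic_third e3 ua (gE a ua) ag.
have gI := inj_eq (@perm_inj _ g).
have gga : g (g a) = c.
  case: (E _ (gE _ (gE _ ua))) => // Eb; last by have := ga; rewrite -gI Eb eqxx.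
  case: (E _ (gE _ uc)) => Ec.
  - by have := cb; rewrite -gI Ec Eb eqxx.
  - by have := ca; rewrite -gI Ec eqxx.
  - by move: ga; rewrite (fix1 c g) ?perm1 ?eqxx.
have gc : g c = a.
  case: (E _ (gE _ uc)) => // Ec; first by have := ca; rewrite -gI Ec eqxx.
  by have := cb; rewrite -gI Ec gga eqxx.
have g3 : g * g * g = 1 by apply: (fix1 a); rewrite ?groupM // !permM ?gu // gga gc.
have := congr1 chi g3; rewrite !chiM ?groupM // (parity1 chiM).
by case: (chi g).
Qed.

(** Characters embed in Z_2 x Z_2 by their values at [x] and [t]. As [x] fixes a vertex,
    [chi x = false] is also necessary for vanishing on the vertex stabilisers. *)
Lemma parity_structure (u0 : V) : exists s (x t : {perm V}),
  [/\ arc_trans e G s, arc_free e G s, x \in G, t \in G & exists u, x u = u] /\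
  forall chi, parity G chi ->
    [/\ chi x = false -> stab0 G chi,
        chi x = false -> chi t = false -> forall g, g \in G -> chi g = false
      & chi x -> s \in [:: 2; 3; 5]].
Proof.
have [w0 uw] : exists a, e u0 a.
  have /card_gt0P[a] : (0 < #|[set y | e u0 y]|)%N by rewrite e3.
  by rewrite inE; exists a.
have [s [s0 Ts Fs]] := arc_regular_exists eS eC e3 GA T1 uw.
have [v [t [Gt tv vE vN]]] := shunt_exists eS e3 GA s0 Ts uw.
suff [x [Gx [u xu] H]] : exists x, [/\ x \in G, exists u, x u = u &
    forall chi, parity G chi ->
      (chi x = false -> stab0 G chi) /\ (chi x -> s \in [:: 2; 3; 5])].
  exists s, x, t; split; first by split=> //; exists u.
  move=> chi chiM; have [H1 H2] := H chi chiM; split=> // cx ct.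
  have ut : e (v 0) (t (v 0)) by rewrite tv.
  apply: (parity_eq0 eC GA T1 chiM Gt ut ct) => g Gg gu.
  exact: H1 cx g _ Gg gu.
case: (ltngtP s 1) => [|s2|s1]; first by lia.
  have [x [Gx xv xs]] := swap_exists eS e3 s0 Ts vE vN.
  exists x; split=> // [|chi chiM]; first by exists (v 0); apply: xv.
  split=> [cx|]; last exact: (regularity eS eC e3 GA s2 Fs Gt tv vE vN Gx xv xs T1 chiM).
  exact: (parity_stab0 eS eC e3 GA s2 Fs Gt tv vE vN Gx xv xs T1 chiM).
exists 1; split=> // [|chi chiM]; first by exists u0; rewrite perm1.
rewrite (parity1 chiM); split=> // _; apply: parity_stab0_free1 => //.
by rewrite -s1.
Qed.

End Structure.

(** * Two-covers *)

Section Cover.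
Variables (V1 V0 : finType) (e1 : rel V1) (e0 : rel V0) (p : V1 -> V0).
Hypothesis e1S : symmetric e1.
Hypothesis pC : two_cover e1 e0 p.
Variables (G0 : {group {perm V0}}) (G1 : {group {perm V1}}).
Hypothesis G0L : lifts e1 p G0.
Hypothesis G1E : (G1 : {set _}) = lifted e1 p G0.

Lemma cover_hom x y : e1 x y -> e0 (p x) (p y).
Proof. by case: pC => -[H _ _ _] _; apply: H. Qed.

Lemma cover_surj z : exists x, p x = z.
Proof. by case: pC => -[_ H _ _] _; apply: H. Qed.

Lemma cover_inj x y z : e1 x y -> e1 x z -> p y = p z -> y = z.
Proof.
by case: pC => -[_ _ /(_ x)[H _] _] _ xy xz; apply: H; rewrite inE.
Qed.

Lemma cover_lift_edge x z : e0 (p x) z -> exists2 y, e1 x y & p y = z.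
Proof.
case: pC => -[_ _ /(_ x)[_ H] _] _ xz.
have : z \in [set z | e0 (p x) z] by rewrite inE.
by rewrite -H => /imsetP[y]; rewrite inE => xy ->; exists y.
Qed.

Lemma cover_fibre x y : p x = p y -> exists2 c, c \in CT e1 p & c x = y.
Proof. by case: pC => -[_ _ _ H] _; apply: H. Qed.

Lemma cover_cubic : cubic_graph e0 -> cubic_graph e1.
Proof.
move=> e3 x; case: pC => -[_ _ /(_ x)[H E] _] _.
by rewrite -(card_in_imset H) E e3.
Qed.

Lemma CTP c : reflect (c \in GAut e1 /\ forall x, p (c x) = p x) (c \in CT e1 p).
Proof.
rewrite [in X in reflect _ X]inE; apply: (iffP andP) => -[Ac H]; split=> //.
  by move=> x; apply/eqP; move/forallP: H.
by apply/forallP=> x; rewrite H.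
Qed.

Lemma liftedP g : reflect (g \in GAut e1 /\ exists2 h, h \in G0 & forall x, p (g x) = h (p x))
  (g \in G1).
Proof.
rewrite G1E [in X in reflect _ X]inE; apply: (iffP andP) => -[Ag].
  by case/exists_inP=> h Gh /forallP H; split=> //; exists h => // x; apply/eqP.
by case=> h Gh H; split=> //; apply/exists_inP; exists h => //; apply/forallP=> x; rewrite H.
Qed.

Lemma CT_sub c : c \in CT e1 p -> c \in G1.
Proof.
move=> /CTP[Ac H]; apply/liftedP; split=> //; exists 1; first exact: group1.
by move=> x; rewrite perm1 H.
Qed.

(** The permutation induced on the base, unique by surjectivity of [p]; the default 1 is taken when
    [g] does not preserve the fibres. *)
Definition proj (g : {perm V1}) : {perm V0} :=
  odflt 1 [pick h : {perm V0} | [forall x, p (g x) == h (p x)]].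

Lemma projE (g : {perm V1}) (h : {perm V0}) : (forall x, p (g x) = h (p x)) -> proj g = h.
Proof.
move=> gh; rewrite /proj; case: pickP => [k /forallP gk|/(_ h)/forallP[]] /=; last first.
  by move=> x; rewrite gh.
by apply/permP=> z; have [x <-] := cover_surj z; rewrite -gh (eqP (gk x)).
Qed.

Lemma proj_lifted g : g \in G1 -> proj g \in G0 /\ forall x, p (g x) = proj g (p x).
Proof. by move=> /liftedP[_ [h Gh gh]]; rewrite (projE gh). Qed.

Lemma proj_CT c : c \in CT e1 p -> proj c = 1.
Proof. by move=> /CTP[_ H]; apply: projE => x; rewrite perm1. Qed.

Lemma lift_exists g : g \in G0 ->
  exists gt, [/\ gt \in G1, proj gt = g & forall x, p (gt x) = g (p x)].
Proof.
move=> Gg; have [gt [Agt H]] := G0L Gg; exists gt; split=> //; last exact: projE.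
by apply/liftedP; split=> //; exists g.
Qed.

Lemma lift_exists_at g x y : g \in G0 -> g (p x) = p y ->
  exists gt, [/\ gt \in G1, proj gt = g, forall z, p (gt z) = g (p z) & gt x = y].
Proof.
move=> Gg gxy; have [h [Gh hg H]] := lift_exists Gg.
have [c Cc cx] : exists2 c, c \in CT e1 p & c (h x) = y by apply: cover_fibre; rewrite H.
have HE z : p ((h * c) z) = g (p z) by rewrite permM (CTP _ Cc).2 H.
exists (h * c); split=> //; [exact: groupM Gh (CT_sub Cc)|exact: projE|by rewrite permM].
Qed.

Lemma lifted_GAut : G1 \subset GAut e1.
Proof. by apply/subsetP=> g /liftedP[]. Qed.

Lemma cover_arc s f : is_arc e1 s f -> is_arc e0 s (fun i => p (f i)).
Proof.
move=> [A B]; split=> i Hi; first by apply: cover_hom; apply: A.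
apply: contra (B i Hi) => /eqP E; apply/eqP/(@cover_inj (f i.+1)) => //.
  by rewrite e1S; apply: A; lia.
exact: A.
Qed.

Lemma cover_lift_arc s f x : is_arc e0 s f -> p x = f 0 ->
  exists f', [/\ is_arc e1 s f', f' 0 = x & forall i, (i <= s)%N -> p (f' i) = f i].
Proof.
move=> fA px; elim: s fA => [|s IH] fA.
  by exists (fun=> x); split=> // -[].
have [f' [fA' f0 fp]] := IH (is_arc_prefix (leqnSn s) fA).
have : e0 (p (f' s)) (f s.+1) by rewrite fp // fA.1.
case/cover_lift_edge=> y sy py; exists (snoc s f' y); split.
- apply: is_arc_snoc => // k Es; apply: contraNneq (fA.2 k _); last by lia.
  by rewrite -Es -py -fp; [move->|lia].
- by rewrite /snoc.
- move=> i Hi; rewrite /snoc; case: leqP => Hs; first exact: fp.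
  by have -> : i = s.+1 by lia.
Qed.

Lemma lifted_arc_trans : arc_trans e0 G0 1%N -> arc_trans e1 G1 1%N.
Proof.
move=> T f f' fA fA'.
have [g Gg H] := T _ _ (cover_arc fA) (cover_arc fA').
have [gt [Ggt _ gp g0]] := lift_exists_at Gg (H 0 isT).
exists gt => // -[|[]] // _.
apply: (@cover_inj (f' 0)); last by rewrite gp (H 1%N).
  by rewrite -g0 (edgeG lifted_GAut) // fA.1.
exact: fA'.1.
Qed.

Lemma arc_trans_down s : arc_trans e1 G1 s -> arc_trans e0 G0 s.
Proof.
move=> T f f' fA fA'.
have [x px] := cover_surj (f 0); have [y py] := cover_surj (f' 0).
have [a [aA _ ap]] := cover_lift_arc fA px; have [b [bA _ bp]] := cover_lift_arc fA' py.
have [g Gg H] := T _ _ aA bA; have [Gpg gp] := proj_lifted Gg.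
by exists (proj g) => // i Hi; rewrite -ap // -gp H // bp.
Qed.

(** A lift of [g] that fixes the first vertex of a lifted arc fixes the whole of it, by local
    injectivity, and is therefore trivial. *)
Lemma arc_free_down s : arc_free e1 G1 s -> arc_free e0 G0 s.
Proof.
move=> F f g fA Gg gf.
have [x px] := cover_surj (f 0).
have [a [aA ax ap]] := cover_lift_arc fA px.
have [|gt [Ggt pgt gp g0]] := @lift_exists_at g (a 0) (a 0) Gg; first by rewrite ap // gf.
suff ga i : (i <= s)%N -> gt (a i) = a i.
  by rewrite -pgt (F a gt aA Ggt ga); apply: projE => z; rewrite !perm1.
elim: i => // i IH Hi; have {}IH := IH (ltnW Hi).
apply: (@cover_inj (a i)); last by rewrite gp ap // gf.
  by rewrite -{1}IH (edgeG lifted_GAut) // aA.1.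
exact: aA.1.
Qed.

Lemma CT1 : 1 \in CT e1 p.
Proof.
apply/CTP; split=> [|x]; rewrite ?perm1 // inE; apply/forallP=> x.
by apply/forallP=> y; rewrite !perm1.
Qed.

Lemma CT_gen : exists c, [/\ c \in CT e1 p, c != 1 & forall d, d \in CT e1 p -> d = 1 \/ d = c].
Proof.
have C1 := CT1.
case: pC => _ /eqP/cards2P[a [b [ab E]]].
move: C1; rewrite E => /set2P[] E1; [exists b|exists a]; subst.
  by split=> [||d /set2P //]; rewrite ?set22 // eq_sym.
by split=> [||d /set2P[]->]; rewrite ?set21 //; [right|left].
Qed.

Lemma projM : {in G1 &, {morph proj : g h / g * h}}.
Proof.
move=> g h Gg Gh; apply: projE => x; rewrite !permM.
by rewrite (proj_lifted Gh).2 (proj_lifted Gg).2.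
Qed.

Lemma proj_stab g u : g \in G1 -> g u = u -> proj g (p u) = p u.
Proof. by move=> Gg gu; rewrite -(proj_lifted Gg).2 gu. Qed.

Lemma lift_stab g w : g \in G0 -> g w = w ->
  exists gt u, [/\ gt \in G1, gt u = u & proj gt = g].
Proof.
move=> Gg gw; have [u pu] := cover_surj w.
have [|gt [Ggt pgt _ gu]] := @lift_exists_at g u u Gg; first by rewrite pu.
by exists gt, u.
Qed.

Section Complement.
Variable H : {group {perm V1}}.
Hypothesis HC : H \in [complements to CT e1 p in lifted e1 p G0].

Lemma compl_subset g : g \in H -> g \in G1.
Proof.
move: HC; rewrite -G1E => /complP[_ E] Hg; rewrite -E; apply/mulsgP.
by exists 1 g; rewrite ?mul1g ?CT1.
Qed.

Lemma compl_CT c : c \in CT e1 p -> c != 1 -> c \notin H.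
Proof.
move: HC => /complP[E _] Cc; apply: contra => Hc.
have : c \in CT e1 p :&: H by rewrite in_setI Cc.
by rewrite E => /set1P->.
Qed.

Lemma compl_decomp g : g \in G1 -> exists c h, [/\ c \in CT e1 p, h \in H & g = c * h].
Proof.
by move: HC; rewrite -G1E => /complP[_ <-] /mulsgP[c h Cc Hh ->]; exists c, h.
Qed.

Lemma compl_parity : parity G1 (fun g => g \notin H).
Proof.
move=> x y Gx Gy; case: (boolP (x \in H)) => Hx; first by rewrite groupMl.
case: (boolP (y \in H)) => Hy; first by rewrite groupMr // (negbTE Hx).
have [c [_ _ cE]] := CT_gen.
have key g : g \in G1 -> g \notin H -> exists2 h, h \in H & g = c * h.
  move=> Gg Hg; have [d [h [Cd Hh E]]] := compl_decomp Gg; exists h => //.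
  by case: (cE d Cd) => Ed; rewrite E Ed // mul1g in Hg *; rewrite Hh in Hg.
have [||h Hh Ex] := key x^-1; rewrite ?groupV //.
have [h' Hh' Ey] := key y Gy Hy.
have -> : x * y = h^-1 * h' by rewrite -[x]invgK Ex invMg Ey mulgA mulgKV.
by rewrite groupM ?groupV.
Qed.

Hypothesis VT : forall x y, exists2 g, g \in G1 & g x = y.

(** An [H]-orbit is a section. It meets every fibre because [k] or [k * c] lies in [H]; two of its
    points in one fibre would give an element outside [H] fixing [v]. *)
Lemma sectional_compl : stab0 G1 (fun g => g \notin H) -> sectional p H.
Proof.
move=> st; have [c [Cc c1 cE]] := CT_gen; have Gc := CT_sub Cc.
have [v _] : exists v, c v != v.
  apply/existsP; apply: contraR c1; rewrite negb_exists => /forallP cv.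
  by apply/eqP/permP=> x; rewrite perm1; apply/eqP; have := cv x; rewrite negbK.
exists [set h v | h : {perm V1} in H] => [z|h Hh]; last first.
  apply/eqP; rewrite eqEcard card_imset ?leqnn ?andbT; last exact: perm_inj.
  apply/subsetP=> _ /imsetP[_ /imsetP[k Hk ->] ->]; apply/imsetP.
  by exists (k * h); [apply: groupM|rewrite permM].
have [x px] := cover_surj z; have [k Gk kx] := VT v x.
have [u Su pu] : exists2 u, u \in [set h v | h : {perm V1} in H] & p u = z.
  case: (boolP (k \in H)) => Hk.
    by exists x => //; apply/imsetP; exists k.
  exists (c x); last by rewrite (CTP _ Cc).2.
  apply/imsetP; exists (k * c); last by rewrite permM kx.
  by apply/negPn; rewrite (compl_parity Gk Gc) Hk (compl_CT Cc c1).
apply/eqP/cards1P; exists u; apply/setP=> w; rewrite !inE.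
apply/andP/eqP=> [[Sw /eqP pw]|->]; last by rewrite pu.
have [d Cd du] := cover_fibre (etrans pu (esym pw)).
case: (cE d Cd) => Ed; first by rewrite -du Ed perm1.
case/imsetP: Su => h Hh uh; case/imsetP: Sw => h' Hh' wh.
have Gh := compl_subset Hh; have Gh' := compl_subset Hh'.
have /negbFE : (h * c * h'^-1 \notin H) = false.
  by apply: (st _ v); rewrite ?groupM ?groupV // !permM -uh -Ed du wh permK.
by rewrite groupMr ?groupV // groupMl // (negbTE (compl_CT Cc c1)).
Qed.

(** If [g] outside [H] fixes [u], then for each [k] in [G1] one of [k] and [g * k] lies in [H], and
    both send [u] to the same vertex. *)
Lemma transitive_complement : ~ stab0 G1 (fun g => g \notin H) -> transitive_compl H.
Proof.
move=> nst; have [g [u [Gg gu Hg]]] : exists g u, [/\ g \in G1, g u = u & g \notin H].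
  apply: NNPP => N; apply: nst => g u Gg gu; apply: negbTE; apply/negP=> Hg.
  by apply: N; exists g, u.
apply/imsetP; exists u; rewrite ?inE //; apply/setP=> y; rewrite inE; apply/esym/orbitP.
have [k Gk ky] := VT u y; case: (boolP (k \in H)) => Hk; first by exists k.
exists (g * k); last by rewrite /= /aperm permM gu.
by apply/negPn; rewrite (compl_parity Gg Gk) Hk Hg.
Qed.

End Complement.

(** The converse of [compl_parity]: the kernel of a character that is nontrivial on the covering
    transformations is a complement. *)
Lemma compl_of_parity chi : parity G1 chi ->
  (forall c, c \in CT e1 p -> c != 1 -> chi c) ->
  exists2 H : {group {perm V1}}, H \in [complements to CT e1 p in lifted e1 p G0] &
    forall g, g \in G1 -> (g \notin H) = chi g.
Proof.
move=> chiM chiC; pose K := [set g in G1 | ~~ chi g].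
have gK : group_set K.
  apply/group_setP; split; first by rewrite inE group1 (parity1 chiM).
  move=> x y; rewrite !inE => /andP[Gx cx] /andP[Gy cy].
  by rewrite groupM // chiM // (negbTE cx) (negbTE cy).
have [c [Cc c1 cE]] := CT_gen; have Gc := CT_sub Cc.
exists (Group gK) => [|g Gg]; last by rewrite inE Gg negbK.
rewrite -G1E; apply/complP; split.
  apply/setP=> g; rewrite in_setI in_set1; apply/andP/eqP => [[Cg]|->].
    by rewrite inE => /andP[_ cg]; apply/eqP; apply: contraNT cg; apply: chiC.
  by rewrite CT1 inE group1 (parity1 chiM).
apply/setP=> g; apply/mulsgP/idP => [[d h Cd]|Gg].
  by rewrite inE => /andP[Gh _] ->; rewrite groupM // CT_sub.
case: (boolP (chi g)) => cg.
  exists c (c^-1 * g); rewrite ?mulKVg // inE groupM ?groupV //=.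
  by rewrite chiM ?groupV // (parityV chiM) // cg chiC.
by exists 1 g; rewrite ?mul1g ?CT1 // inE Gg.
Qed.

End Cover.

(** * Passage between tuples and sequences of vertices *)

Section RegularTuples.
Variables (V : finType) (e : rel V).

Lemma s_arcP s (a : s.+1.-tuple V) (x : V) : s_arc e a -> is_arc e s (nth x a).
Proof.
move=> [A B]; split=> i Hi.
  have := A (Ordinal (ltnW Hi : (i < s.+1)%N)) (Ordinal (Hi : (i.+1 < s.+1)%N)) erefl.
  by rewrite !(tnth_nth x).
have Hi1 : (i < s.+1)%N by lia.
have Hi2 : (i.+2 < s.+1)%N by lia.
have := B (Ordinal Hi1) (Ordinal Hi2) erefl.
by rewrite !(tnth_nth x) /= => /eqP.
Qed.

Lemma map_tupleP s (a b : s.+1.-tuple V) (x : V) (g : V -> V) :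
  map_tuple g a = b <-> forall i, (i <= s)%N -> g (nth x a i) = nth x b i.
Proof.
split=> [<- i Hi|H]; first by rewrite (nth_map x) // size_tuple.
apply: val_inj; apply: (@eq_from_nth _ x) => [|i]; rewrite size_map !size_tuple // => Hi.
by rewrite (nth_map x) ?size_tuple // H.
Qed.

Lemma s_regular_of (G : {group {perm V}}) s :
  arc_trans e G s -> arc_free e G s -> s_regular e s G.
Proof.
move=> T F a b aA bA; have x := thead a.
have [g Gg /(map_tupleP a b) gab] := T _ _ (s_arcP x aA) (s_arcP x bA).
exists g; split=> // h [Gh hab].
suff E : g * h^-1 = 1 by rewrite -[h]mul1g -E mulgKV.
apply: (F (nth x a)); first exact: s_arcP.
  by rewrite groupM ?groupV.
move=> i Hi; rewrite permM; apply: (@perm_inj _ h); rewrite permKV.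
by move/(map_tupleP a b x): gab => ->//; move/(map_tupleP a b x): hab => ->.
Qed.

Lemma arc_trans1_of (G : {group {perm V}}) : arc_transitive e G -> arc_trans e G 1%N.
Proof.
move=> T f f' fA fA'.
have arc2 h : is_arc e 1 h -> s_arc (s := 1) e [tuple h 0; h 1%N].
  move=> [A _]; split=> -[[|[|i]] Hi] [[|[|j]] Hj] //= _.
  by rewrite !(tnth_nth (h 0)) /=; apply: A.
have [g Gg /(map_tupleP _ _ (f 0)) H] := T _ _ (arc2 _ fA) (arc2 _ fA').
by exists g => // -[|[|i]] // Hi; [apply: (H 0)|apply: (H 1%N)].
Qed.

End RegularTuples.

(** * Epimorphisms compatible with vertex stabilisers *)

Record stab_epi (V1 V0 : finType) (G1 : {set {perm V1}}) (G0 : {set {perm V0}})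
    (f : {perm V1} -> {perm V0}) : Prop := StabEpi {
  epi_in : forall g, g \in G1 -> f g \in G0;
  epiM : {in G1 &, {morph f : g h / g * h}};
  epi_onto : forall g, g \in G0 -> exists2 gt, gt \in G1 & f gt = g;
  epi_stab : forall g u, g \in G1 -> g u = u -> exists w, f g w = w;
  epi_lift_stab : forall g w, g \in G0 -> g w = w ->
    exists gt u, [/\ gt \in G1, gt u = u & f gt = g] }.

Lemma stab_epi_comp (V2 V1 V0 : finType) (G2 : {set {perm V2}}) (G1 : {set {perm V1}})
    (G0 : {set {perm V0}}) f g :
  stab_epi G2 G1 f -> stab_epi G1 G0 g -> stab_epi G2 G0 (g \o f).
Proof.
move=> A B; split=> /=.
- by move=> x Gx; apply/(epi_in B)/(epi_in A).
- by move=> x y Gx Gy /=; rewrite (epiM A) // (epiM B) //; apply: (epi_in A).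
- move=> x /(epi_onto B)[y Gy <-]; have [z Gz <-] := epi_onto A Gy.
  by exists z.
- move=> x u Gx xu; have [w xw] := epi_stab A Gx xu.
  exact: (epi_stab B (epi_in A Gx) xw).
- move=> x w Gx xw; have [y [u [Gy yu <-]]] := epi_lift_stab B Gx xw.
  by have [z [t [Gz zt <-]]] := epi_lift_stab A Gy yu; exists z, t.
Qed.

Lemma parity_epi (V1 V0 : finType) (G1 : {set {perm V1}}) (G0 : {set {perm V0}}) f chi :
  stab_epi G1 G0 f -> parity G0 chi -> parity G1 (chi \o f).
Proof. by move=> A chiM x y Gx Gy /=; rewrite (epiM A) // chiM // (epi_in A). Qed.

(** This lets the type of a complement at a lower level be read off from its character pulled back
    to a higher one. *)
Lemma stab0_epi (V1 V0 : finType) (G1 : {set {perm V1}}) (G0 : {set {perm V0}}) f chi :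
  stab_epi G1 G0 f -> stab0 G1 (chi \o f) <-> stab0 G0 chi.
Proof.
move=> A; split=> H g u Gg gu.
  have [gt [w [Ggt gw <-]]] := epi_lift_stab A Gg gu; exact: H gw.
by have [w gw] := epi_stab A Gg gu; apply: H (epi_in A Gg) gw.
Qed.

Lemma parity_add (gT : finGroupType) (G : {set gT}) a b :
  parity G a -> parity G b -> parity G (fun x => a x (+) b x).
Proof. by move=> A B x y Gx Gy; rewrite A // B // addbACA. Qed.

Lemma parity_scale (gT : finGroupType) (G : {set gT}) (k : bool) a :
  parity G a -> parity G (fun x => k && a x).
Proof. by move=> A x y Gx Gy; rewrite A //; case: k. Qed.

(** * Chains of two-covers *)

Section Chain.
Unset Implicit Arguments.
Variables (n : nat) (V : nat -> finType) (e : forall j, rel (V j)).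
Variables (p : forall j, V j.+1 -> V j) (G : forall j, {group {perm V j}}).
Set Implicit Arguments.
Hypothesis gE : forall j, j <= n -> simple_graph (e j) /\ connected_graph (e j).
Hypothesis e3 : cubic_graph (e 0).
Hypothesis GA0 : G 0 \subset GAut (e 0).
Hypothesis T0 : arc_transitive (e 0) (G 0).
Hypothesis pC : forall j, j < n -> two_cover (e j.+1) (e j) (p j).
Hypothesis GL : forall j, j < n -> lifts (e j.+1) (p j) (G j) /\
  (G j.+1 : {set _}) = lifted (e j.+1) (p j) (G j).

Lemma level_sym j : j <= n -> symmetric (e j).
Proof. by case/gE=> -[]. Qed.

Lemma level_facts j : j <= n ->
  [/\ cubic_graph (e j), G j \subset GAut (e j) & arc_trans (e j) (G j) 1%N].
Proof.
elim: j => [_|j IH jn]; first by split=> //; apply: arc_trans1_of.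
have [c3 A T] := IH (ltnW jn); have [L E] := GL jn.
split; first exact: cover_cubic (pC jn) c3.
  exact: lifted_GAut E.
exact: (lifted_arc_trans (level_sym jn) (pC jn) L E T).
Qed.

Lemma level_vertex_trans j : j <= n -> forall x y, exists2 g, g \in G j & g x = y.
Proof.
move=> jn; have [_ _ T] := level_facts jn.
exact: vertex_trans (level_sym jn) (gE jn).2 _ T.
Qed.

Lemma proj_stab_epi j : j < n -> stab_epi (G j.+1) (G j) (proj (p j)).
Proof.
move=> jn; have [L E] := GL jn; split.
- by move=> g /(proj_lifted (pC jn) E)[].
- by move=> g h Gg Gh; apply: (projM (pC jn) E).
- by move=> g Gg; have [gt [? ? _]] := lift_exists (pC jn) L E Gg; exists gt.
- by move=> g u Gg gu; exists (p j u); apply: (proj_stab (pC jn) E).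
- exact: (lift_stab (pC jn) L E).
Qed.

(** The source level is written [d + k] because [d.+1 + k] reduces to [(d + k).+1], so that
    projections compose without casts. *)
Fixpoint projn d k : {perm V (d + k)} -> {perm V k} :=
  if d is d'.+1 then fun g : {perm V (d' + k).+1} => @projn d' k (proj (p (d' + k)) g)
  else id.

Lemma projn_stab_epi d k : d + k <= n -> stab_epi (G (d + k)) (G k) (@projn d k).
Proof.
elim: d => [|d IH] dk; last exact: stab_epi_comp (proj_stab_epi dk) (IH (ltnW dk)).
split=> //= [g Gg|g u _ gu|g w Gg gw]; [by exists g|by exists u|by exists g, w].
Qed.

(** Covering transformations project to 1, so characters pulled back from below vanish on them; this
    is the source of linear independence. *)
Lemma projn_CT d k c (chi : {perm V k} -> bool) : d + k < n -> parity (G k) chi ->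
  c \in CT (e (d + k).+1) (p (d + k)) -> chi (@projn d.+1 k c) = false.
Proof.
move=> dk chiM Cc /=; rewrite (proj_CT (pC dk) Cc).
exact: (parity1 (parity_epi (projn_stab_epi (ltnW dk)) chiM)).
Qed.

Lemma regular_base m s : m <= n -> arc_trans (e m) (G m) s -> arc_free (e m) (G m) s ->
  s_regular (e 0) s (G 0).
Proof.
elim: m => [_|m IH mn] T F; first exact: s_regular_of.
have [L E] := GL mn; apply: IH; first exact: ltnW.
  exact: (arc_trans_down (pC mn) E T).
exact: (arc_free_down (pC mn) L E F).
Qed.

Lemma level_structure j : j < n -> exists s (x t : {perm V j.+1}),
  [/\ arc_trans (e j.+1) (G j.+1) s, arc_free (e j.+1) (G j.+1) s,
      x \in G j.+1, t \in G j.+1 & exists u, x u = u] /\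
  forall chi, parity (G j.+1) chi ->
    [/\ chi x = false -> stab0 (G j.+1) chi,
        chi x = false -> chi t = false -> forall g, g \in G j.+1 -> chi g = false
      & chi x -> s \in [:: 2; 3; 5]].
Proof.
move=> jn; have [c3 A T] := level_facts jn.
have [c [_ c1 _]] := CT_gen (pC jn).
have [u0 _] : exists u, c u != u.
  apply/existsP; apply: contraR c1; rewrite negb_exists => /forallP cu.
  by apply/eqP/permP=> u; rewrite perm1; apply/eqP/negPn.
exact: (parity_structure (level_sym jn) (gE jn).2 c3 A T u0).
Qed.

Notation complements j := [complements to CT (e j.+1) (p j) in lifted (e j.+1) (p j) (G j)].

Section Complement.
Variables (j : nat) (H : {group {perm V j.+1}}).
Hypotheses (jn : j < n) (HC : H \in complements j).

Lemma level_parity : parity (G j.+1) (fun g => g \notin H).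
Proof. exact: (compl_parity (pC jn) (GL jn).2 HC). Qed.

Lemma level_sectional : stab0 (G j.+1) (fun g => g \notin H) -> sectional (p j) H.
Proof. exact: (sectional_compl (pC jn) (GL jn).2 HC (level_vertex_trans jn)). Qed.

Lemma level_transitive : ~ stab0 (G j.+1) (fun g => g \notin H) -> transitive_compl H.
Proof. exact: (transitive_complement (pC jn) (GL jn).2 HC (level_vertex_trans jn)). Qed.

End Complement.

Lemma CT_witness j : j < n -> exists c,
  [/\ c \in CT (e j.+1) (p j), c \in G j.+1
    & forall H : {group {perm V j.+1}}, H \in complements j -> c \notin H].
Proof.
move=> jn; have [c [Cc c1 _]] := CT_gen (pC jn); exists c; split=> //.
  exact: CT_sub (GL jn).2 _ Cc.
by move=> H HC; apply: (compl_CT HC).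
Qed.

(** Evaluated at [ck], [b] and [a], the three pulled-back characters form a triangular matrix with
    ones on the diagonal. Three independent characters cannot embed in Z_2 x Z_2. *)
Lemma no_three_splits i j k : i < j -> j < k -> k < n ->
  ~ [/\ split_rel (e i.+1) (p i) (G i), split_rel (e j.+1) (p j) (G j)
      & split_rel (e k.+1) (p k) (G k)].
Proof.
move=> ij jk kn [[_ [Hi HiC]] [_ [Hj HjC]] [_ [Hk HkC]]].
have jn : j < n by apply: ltn_trans kn.
have i_n : i < n by apply: ltn_trans jn.
have Ei := level_parity i_n HiC; have Ej := level_parity jn HjC; have Ek := level_parity kn HkC.
have [ci [_ Gci ciN]] := CT_witness i_n; have [cj [Ccj Gcj cjN]] := CT_witness jn.
have [ck [Cck Gck ckN]] := CT_witness kn.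
move/ciN: HiC => ciH; move/cjN: HjC => cjH; move/ckN: HkC => ckH {ciN cjN ckN}.
have [d jE] : exists d, j = d + i.+1 by exists (j - i.+1); rewrite subnK.
subst j; have [d' kE] : exists d', k = d' + (d + i.+1).+1.
  by exists (k - (d + i.+1).+1); rewrite subnK.
subst k.
have A0 := projn_CT jn Ei Ccj.
pose f := @projn d'.+1 (d + i.+1).+1.
have gE' : stab_epi (G (d + i.+1).+1) (G i.+1) (@projn d.+1 i.+1).
  exact: (@projn_stab_epi d.+1 i.+1 jn).
have pA : parity (G (d + i.+1).+1) ((fun g => g \notin Hi) \o @projn d.+1 i.+1).
  exact: parity_epi gE' Ei.
have fE : stab_epi (G (d' + (d + i.+1).+1).+1) (G (d + i.+1).+1) f.
  exact: (@projn_stab_epi d'.+1 (d + i.+1).+1 kn).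
have [a1 Ga1 a1E] := epi_onto gE' Gci.
have [a Ga aE] := epi_onto fE Ga1; have [b Gb bE] := epi_onto fE Gcj.
have [s [x [t [_ str]]]] := level_structure kn.
pose A := ((fun g => g \notin Hi) \o @projn d.+1 i.+1) \o f.
pose B := (fun g => g \notin Hj) \o f; pose C := fun g => g \notin Hk.
have PA : parity (G (d' + (d + i.+1).+1).+1) A by apply: (parity_epi fE).
have PB : parity (G (d' + (d + i.+1).+1).+1) B by apply: (parity_epi fE).
have Ac : A ck = false := projn_CT kn pA Cck.
have Bc : B ck = false := projn_CT kn Ej Cck.
have Aa : A a = true by rewrite /A /= aE; move: ciH; rewrite -a1E.
have Ab : A b = false by rewrite /A /comp bE.
have Bb : B b = true by rewrite /B /= bE.
have rank l m r : ~~ [&& [|| l, m | r],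
    (l && A x) (+) (m && B x) (+) (r && C x) == false &
    (l && A t) (+) (m && B t) (+) (r && C t) == false].
  apply/negP=> /and3P[lmr /eqP X0 /eqP T0'].
  have P : parity (G (d' + (d + i.+1).+1).+1)
      (fun g => (l && A g) (+) (m && B g) (+) (r && C g)).
    by do 2?[apply: parity_add]; apply: parity_scale.
  have [_ /(_ X0 T0') Z _] := str _ P.
  have := Z _ Gck; rewrite Ac Bc /C ckH !andbF andbT /= => r0.
  have := Z _ Gb; rewrite r0 Ab Bb !andbF andbT addbF /= => m0.
  have := Z _ Ga; rewrite r0 m0 Aa andbT !addbF => l0.
  by rewrite l0 m0 r0 in lmr.
(* The seven nonzero combinations of three vectors of Z_2 x Z_2 cannot all be nonzero. *)
move: (rank true false false) (rank false true false) (rank false false true)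
  (rank true true false) (rank true false true) (rank false true true) (rank true true true).
by case: (A x); case: (B x); case: (C x); case: (A t); case: (B t); case: (C t).
Qed.

(** Both covers are studied on the upper group, where [A H] and [B H'] are independent and so span
    all characters. *)
Lemma two_splits i j : i < j -> j < n ->
  split_rel (e i.+1) (p i) (G i) -> split_rel (e j.+1) (p j) (G j) ->
  ((split_transitive (e i.+1) (p i) (G i) /\
     (split_sectional (e j.+1) (p j) (G j) \/ split_mixed (e j.+1) (p j) (G j))) \/
   (split_transitive (e j.+1) (p j) (G j) /\
     (split_sectional (e i.+1) (p i) (G i) \/ split_mixed (e i.+1) (p i) (G i)))) /\
  exists2 s, s \in [:: 2; 3; 5] & s_regular (e 0) s (G 0).
Proof.
move=> ij jn Si Sj; have i_n : i < n by apply: ltn_trans jn.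
have [ci [_ Gci ciN]] := CT_witness i_n; have [cj [Ccj Gcj cjN]] := CT_witness jn.
have [d jE] : exists d, j = d + i.+1 by exists (j - i.+1); rewrite subnK.
subst j; set f := @projn d.+1 i.+1.
have fE : stab_epi (G (d + i.+1).+1) (G i.+1) f.
  exact: (@projn_stab_epi d.+1 i.+1 jn).
have [s [x [t [[Ts Fs Gx Gt [u xu]] str]]]] := level_structure jn.
have stabE chi : parity (G (d + i.+1).+1) chi ->
    stab0 (G (d + i.+1).+1) chi <-> chi x = false.
  by move=> P; have [H _ _] := str _ P; split=> // st; apply: st xu.
have nz chi g : parity (G (d + i.+1).+1) chi -> g \in G (d + i.+1).+1 -> chi g ->
    chi x || chi t.
  move=> P Gg; apply: contraTT; rewrite negb_or => /andP[/negbTE cx /negbTE ct].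
  by have [_ H _] := str _ P; rewrite H.
have [a Ga aE] := epi_onto fE Gci.
pose A (H : {group {perm V i.+1}}) := (fun g => g \notin H) \o f.
pose B (H : {group {perm V (d + i.+1).+1}}) g := g \notin H.
have PA H : H \in complements i -> parity (G (d + i.+1).+1) (A H).
  by move=> HC; apply: (parity_epi fE); apply: level_parity.
have PB H : H \in complements (d + i.+1) -> parity (G (d + i.+1).+1) (B H).
  by move=> HC; apply: level_parity.
have Acj H : H \in complements i -> A H cj = false.
  by move=> HC; apply: (projn_CT jn (level_parity i_n HC) Ccj).
have nzA H : H \in complements i -> A H x || A H t.
  by move=> HC; apply: (nz _ _ (PA _ HC) Ga); rewrite /A /= aE ciN.
have nzB H : H \in complements (d + i.+1) -> B H x || B H t.
  by move=> HC; apply: (nz _ _ (PB _ HC) Gcj); rewrite /B cjN.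
have nzAB H H' : H \in complements i -> H' \in complements (d + i.+1) ->
    (A H x (+) B H' x) || (A H t (+) B H' t).
  move=> HC HC'; apply: (nz _ _ (parity_add (PA _ HC) (PB _ HC')) Gcj).
  by rewrite Acj // /B cjN.
have [_ [H0 H0C]] := Si; have [_ [K0 K0C]] := Sj.
(* All [A H] vanish at [cj], unlike [B K0], so they coincide as vectors of values at [x] and [t]:
   the lower cover is not mixed. *)
have Auniq H : H \in complements i -> A H x = A H0 x.
  move=> HC; have := nz _ _ (parity_add (parity_add (PA _ HC) (PA _ H0C)) (PB _ K0C)) Gcj.
  rewrite !Acj // /B (cjN _ K0C) => /(_ isT).
  move: (nzA _ HC) (nzA _ H0C) (nzB _ K0C) (nzAB _ _ HC K0C) (nzAB _ _ H0C K0C).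
  rewrite /B; case: (A H x); case: (A H t); case: (A H0 x); case: (A H0 t);
    by case: (x \notin K0); case: (t \notin K0).
have secA H : H \in complements i -> A H x = false -> sectional (p i) H.
  move=> HC Hx; apply: level_sectional => //.
  by apply/(stab0_epi _ fE)/stabE => //; apply: PA.
have traA H : H \in complements i -> A H x = true -> transitive_compl H.
  move=> HC Hx; apply: level_transitive => //.
  by move/(stab0_epi _ fE)/(stabE _ (PA _ HC)); rewrite -/(A H x) Hx.
have secB H : H \in complements (d + i.+1) -> B H x = false -> sectional (p (d + i.+1)) H.
  by move=> HC Hx; apply: level_sectional => //; apply/stabE => //; apply: PB.
have traB H : H \in complements (d + i.+1) -> B H x = true -> transitive_compl H.
  move=> HC Hx; apply: level_transitive => //.
  by move/(stabE _ (PB _ HC)); rewrite -/(B H x) Hx.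
split; last first.
  exists s; last exact: regular_base jn Ts Fs.
  (* One of the two characters is nonzero at [x], for otherwise both would equal the only character
     supported on [t]. *)
  have [_ _ sA] := str _ (PA _ H0C); have [_ _ sB] := str _ (PB _ K0C).
  move: (nzA _ H0C) (nzB _ K0C) (nzAB _ _ H0C K0C) sA sB.
  by case: (A H0 x) => [_ _ _ /(_ isT)|] //; case: (B K0 x) => [_ _ _ _ /(_ isT)|] //=;
    case: (A H0 t); case: (B K0 t).
(* If the lower cover is split-transitive, adding [A H0] to [B K0] gives a second upper complement
   with the opposite value at [x], hence of the opposite type. *)
case Hx: (A H0 x); [left|right].
  split; first by split=> // H HC; apply: traA; rewrite // Auniq.
  right; split=> //.
  have PAB := parity_add (PA _ H0C) (PB _ K0C).
  have [c HC|K KC KE] := compl_of_parity (pC jn) (GL jn).2 PAB.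
    move=> c1; rewrite /B (compl_CT K0C) //.
    by rewrite /A /= (projn_CT jn (level_parity i_n H0C) HC).
  have BK : B K x = ~~ B K0 x by rewrite /B KE // Hx.
  case Bx: (B K0 x) BK => BK; split.
  - by exists K => //; apply: secB.
  - by exists K0 => //; apply: traB.
  - by exists K0 => //; apply: secB.
  - by exists K => //; apply: traB.
(* If the lower cover is split-sectional, independence forces every [B H] to be nonzero at [x]. *)
split; last by left; split=> // H HC; apply: secA; rewrite // Auniq.
split=> // H HC; apply: traB => //.
move: (nzA _ H0C) (nzB _ HC) (nzAB _ _ H0C HC); rewrite Hx.
by case: (A H0 t); case: (B H x); case: (B H t).
Qed.

End Chain.

Unset Implicit Arguments.

(* Chain X_n -> ... -> X_0: vertex types V j, adjacency e j,
   p j : V j.+1 -> V j is the 2-cover wp_{j+1}, G j is the group G_j. *)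
Theorem theorem5p3
  (n : nat) (V : nat -> finType) (e : forall j, rel (V j))
  (p : forall j, V j.+1 -> V j) (G : forall j, {group {perm V j}}) :
  (forall j, j <= n -> simple_graph (e j) /\ connected_graph (e j)) ->
  cubic_graph (e 0) ->
  (G 0 \subset GAut (e 0)) ->
  arc_transitive (e 0) (G 0) ->
  (forall j, j < n -> two_cover (e j.+1) (e j) (p j)) ->
  (forall j, j < n -> lifts (e j.+1) (p j) (G j) /\
                      (G j.+1 : {set _}) = lifted (e j.+1) (p j) (G j)) ->
  (* at most two of the 2-covers are split *)
  (forall i j k, i < j -> j < k -> k < n ->
     ~ [/\ split_rel (e i.+1) (p i) (G i), split_rel (e j.+1) (p j) (G j)
         & split_rel (e k.+1) (p k) (G k)]) /\
  (* if precisely two are split ... *)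
  (forall i j, i < j -> j < n ->
     split_rel (e i.+1) (p i) (G i) -> split_rel (e j.+1) (p j) (G j) ->
     (forall k, k < n -> k <> i -> k <> j -> ~ split_rel (e k.+1) (p k) (G k)) ->
     ((split_transitive (e i.+1) (p i) (G i) /\
        (split_sectional (e j.+1) (p j) (G j) \/ split_mixed (e j.+1) (p j) (G j))) \/
      (split_transitive (e j.+1) (p j) (G j) /\
        (split_sectional (e i.+1) (p i) (G i) \/ split_mixed (e i.+1) (p i) (G i)))) /\
     exists2 s, s \in [:: 2; 3; 5] & s_regular (e 0) s (G 0)).
Proof.
move=> gE e3 GA0 T0 pC GL; split=> [i j k|i j ij jn Si Sj _].
  exact: (no_three_splits gE e3 GA0 T0 pC GL).
exact: (two_splits gE e3 GA0 T0 pC GL ij jn Si Sj).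
Qed.
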